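(* (a) Let $(\Sigma_rG)_\lambda$ be an edge-weighted $r$-path suspension of $G_\omega$ such that $\lambda(v_iv_j)\le\lambda(v_iv_{i,1})$ and $\lambda(v_iv_j)\le\lambda(v_jv_{j,1})$ for all edges $v_iv_j\in E$. Then $$r_{R'}\left(\frac{R'}{I_r(\Sigma_rG)}\right)=\#\{\mathcal p\text{-minimal }r\text{-path vertex covers of }\Sigma_{r-1}G\}.$$ (b) Let $(\Sigma G)_\lambda$ be an edge-weighted suspension of $G_\omega$ such that $\lambda(v_iv_j)\le\lambda(v_iw_i)$ and $\lambda(v_iv_j)\le\lambda(w_jv_j)$ for each $v_iv_j\in E$. Then (with $r=1$ in the definition of $R'$) $$r_{R'}\left(\frac{R'}{I((\Sigma G)_\lambda)}\right)=\#\{\text{minimal edge-weighted vertex covers of }G_\omega\}.$$ (c) Let $\Sigma G$ be the suspension of $G$. Then (with $r=1$ in the definition of $R'$) $$r_{R'}\left(\frac{R'}{I(\Sigma G)}\right)=\#\{\text{minimal vertex covers of }G\}.$$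
   Context: $\mathbb N=\{1,2,\dots\}$. $G$ is a finite simple graph with vertex set $V=\{v_1,\dots,v_d\}$, $d\ge1$, and edge set $E$; the edge between $v_i$ and $v_j$ is written $v_iv_j$. $\mathbb K$ is a field, $r\in\mathbb N$ is fixed, and $R'=\mathbb K[X_{i,j}\mid 1\le i\le d,\ 0\le j\le r]$. An edge-weighting on a graph is a function from its edge set to $\mathbb N$; $G_\omega$ denotes $G$ with an edge-weighting $\omega$. Suspensions. For an integer $s\ge0$, the $s$-path suspension $\Sigma_sG$ is the graph with vertices $v_{i,j}$ ($1\le i\le d$, $0\le j\le s$), where $v_{i,0}=v_i$, whose edges are the edges of $G$ together with $v_{i,j}v_{i,j+1}$ for $1\le i\le d$, $0\le j<s$ (so $\Sigma_0G=G$). An edge-weighted $s$-path suspension $(\Sigma_sG)_\lambda$ of $G_\omega$ is $\Sigma_sG$ with an edge-weighting $\lambda$ such that $\lambda(v_iv_j)=\omega(v_iv_j)$ for all $v_iv_j\in E$. The suspension is $\Sigma G=\Sigma_1G$, with $w_i=v_{i,1}$ (so one new vertex $w_i$ and one new edge $v_iw_i$ is attached at each $v_i$), and an edge-weighted suspension is an edge-weighted $1$-path suspension. Paths. An $r$-path in a graph is a path of length $r$, i.e. $r+1$ distinct vertices $u_1\cdots u_{r+1}$ with consecutive ones adjacent. In an edge-weighted graph, for an $r$-path $Q$ and a vertex $u$ on $Q$, let $e_Q(u)$ be the maximum of the weights of the (one or two) edges of $Q$ containing $u$. Ideals. $I_r((\Sigma_rG)_\lambda)$ is the ideal of $R'$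 generated by the monomials $\prod_{u\in Q}X_u^{e_Q(u)}$ over all $r$-paths $Q$ in $\Sigma_rG$, where $X_u=X_{i,j}$ if $u=v_{i,j}$. $I_r(\Sigma_rG)$ is the ideal obtained when all weights equal $1$, i.e. generated by $\prod_{u\in Q}X_u$ over all $r$-paths $Q$. For $r=1$ write $I((\Sigma G)_\lambda)=I_1((\Sigma_1G)_\lambda)$, generated by $X_u^{\lambda(uu')}X_{u'}^{\lambda(uu')}$ over edges $uu'$ of $\Sigma G$, and $I(\Sigma G)$ for the usual edge ideal, generated by $X_uX_{u'}$ over edges $uu'$ of $\Sigma G$. Type. For a homogeneous ideal $I$ of a polynomial ring $S$ over $\mathbb K$ with $S/I$ Cohen-Macaulay and $n=\dim(S/I)$, the Cohen-Macaulay type is $r_S(S/I)=\dim_{\mathbb K}\operatorname{Ext}^n_S(\mathbb K,S/I)$, where $\mathbb K$ is the quotient of $S$ by the ideal generated by the variables. Vertex covers. An $r$-path vertex cover of a graph $H$ is a set of vertices meeting every $r$-path of $H$; a ($1$-path) vertex cover is a set of vertices meeting every edge, and it is minimal if it is minimal under inclusion. An edge-weighted $r$-path vertex cover of an edge-weighted graph $H_\mu$ is a pair $(V',\delta')$ with $V'\subseteq V(H)$ an $r$-path vertex cover of $H$ and $\delta':V'\to\mathbb N$, such that every $r$-path $Q$ in $H$ contains some $u\in V'$ with $\delta'(u)\le e_Q(u)$. Write $(V_2',\delta_2')\le(V_1',\delta_1')$ if $V_2'\subseteq V_1'$ and $\delta_2'(u)\ge\delta_1'(u)$ for all $u\in V_2'$;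 a cover is minimal if no other edge-weighted $r$-path vertex cover is strictly smaller. An edge-weighted vertex cover is an edge-weighted $1$-path vertex cover. The function $\gamma$. For an edge-weighted $(r-1)$-path suspension $(\Sigma_{r-1}G)_\mu$ let $h_{i,j}$ be the maximum of the weights $\mu$ of the edges of $\Sigma_{r-1}G$ containing $v_{i,j}$ (maximum of the empty set read as $0$). For a pair $\mathfrak P=(V'',\delta'')$ with $V''\subseteq V(\Sigma_{r-1}G)$ and $\delta'':V''\to\mathbb N$, let $q(V'')=\{v_i\mid v_{i,j}\in V''\text{ for some }j\}$, $W_i(\mathfrak P)=\{v_{i,j}\in V''\mid\delta''(v_{i,j})\le h_{i,j}\}$, and define $\gamma_{(V'',\delta'')}:q(V'')\to\mathbb N\sqcup\{\infty\}$ by $\gamma_{(V'',\delta'')}(v_i)=\min\{\delta''(v_{i,j})+\sum_{k=0}^{j-1}h_{i,k}\mid v_{i,j}\in W_i(\mathfrak P)\}$ if $W_i(\mathfrak P)\ne\emptyset$, and $\infty$ otherwise. $\mathcal p$-minimality. For minimal edge-weighted $r$-path vertex covers of $(\Sigma_{r-1}G)_\mu$, write $(V_1'',\delta_1'')\le_{\mathcal p}(V_2'',\delta_2'')$ if $q(V_1'')\subseteq q(V_2'')$ and $\gamma_{(V_1'',\delta_1'')}(v)\ge\gamma_{(V_2'',\delta_2'')}(v)$ for all $v\in q(V_1'')$; write $A<_{\mathcal p}B$ if $A\le_{\mathcal p}B$ and not $B\le_{\mathcal p}A$. A minimal edge-weighted $r$-path vertex cover $(V'',\delta'')$ is $\mathcal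 p$-minimal if there is no minimal edge-weighted $r$-path vertex cover $(V''',\delta''')$ with $(V''',\delta''')<_{\mathcal p}(V'',\delta'')$. The $\mathcal p$-minimal $r$-path vertex covers of the unweighted graph $\Sigma_{r-1}G$ are the $\mathcal p$-minimal edge-weighted $r$-path vertex covers of $\Sigma_{r-1}G$ equipped with the constant edge-weighting $1$. *)

(* Defs.v *)
From HB Require Import structures.
From mathcomp Require Import all_boot all_order all_algebra.
From mathcomp Require Import mpoly.

Set Implicit Arguments.
Unset Strict Implicit.
Unset Printing Implicit Defensive.

Import GRing.Theory.

(* Generated ideals are Prop-valued predicates, since membership in them has no
   boolean test; in a chain of primes we use the library's boolean predicates
   (every predicate is boolean under classical axioms). *)
Section CommutativeAlgebra.
Local Open Scope ring_scope.

Definition ideal_gen (A : comNzRingType) (G : A -> Prop) (f : A) : Prop :=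
  exists s : seq (A * A),
    (forall p, p \in s -> G p.2) /\ f = \sum_(p <- s) p.1 * p.2.

(* A chain P_0 < ... < P_n of prime ideals containing I, i.e. of prime ideals
   of A / I.  Properness of the P_i is part of [idealr_closed]. *)
Definition prime_chain (A : comNzRingType) (I : A -> Prop) (n : nat)
    (P : nat -> {pred A}) : Prop :=
  (forall i, (i <= n)%N ->
     [/\ idealr_closed (P i), prime_idealr_closed (P i)
       & forall f, I f -> f \in P i]) /\
  (forall i, (i < n)%N ->
     {subset P i <= P i.+1} /\ exists2 f, f \in P i.+1 & f \notin P i).

Definition krull_dim (A : comNzRingType) (I : A -> Prop) (n : nat) : Prop :=
  (exists P, prime_chain I n P) /\
  (forall m P, prime_chain I m P -> (m <= n)%N).

Definition regular_seq (A : comNzRingType) (I : A -> Prop) (s : seq A) : Prop :=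
  let I_ i := ideal_gen (fun f => I f \/ f \in take i s) in
  (forall i f, (i < size s)%N -> I_ i (s`_i * f) -> I_ i f) /\
  ~ I_ (size s) 1.

(* The depth of A / I with respect to the ideal J. *)
Definition depth (A : comNzRingType) (J I : A -> Prop) (n : nat) : Prop :=
  (exists s, [/\ forall f, f \in s -> J f, regular_seq I s & size s = n]) /\
  (forall s, (forall f, f \in s -> J f) -> regular_seq I s -> (size s <= n)%N).

(* Resolutions ... -> A^(rk 1%N) -> A^(rk 0%N) -> A / J -> 0 by free modules of
   finite rank; the maps act on row vectors by right multiplication. *)
Record free_resolution (A : comNzRingType) (J : A -> Prop) := FreeResolution {
  rk : nat -> nat;
  aug : 'cV[A]_(rk 0%N);
  diff : forall i, 'M[A]_(rk i.+1, rk i);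
  aug_surj : forall a : A, exists u : 'rV[A]_(rk 0%N), J ((u *m aug) 0 0 - a);
  exact_aug : forall u : 'rV[A]_(rk 0%N),
    J ((u *m aug) 0 0) <-> exists v : 'rV[A]_(rk 1%N), u = v *m diff 0%N;
  exact_diff : forall i (u : 'rV[A]_(rk i.+1)),
    u *m diff i = 0 <-> exists v : 'rV[A]_(rk i.+2), u = v *m diff i.+1
}.

(* The complex Hom(F, A / I): a homomorphism A^b -> A / I is represented by
   the column h in A^b of lifts of the images of the basis vectors, determined
   modulo I; precomposition with a matrix is left multiplication by it. *)
Definition col_in (A : comNzRingType) (I : A -> Prop) b (h : 'cV[A]_b) : Prop :=
  forall t, I (h t 0).

Definition cocycle (A : comNzRingType) (J I : A -> Prop)
    (F : free_resolution J) (i : nat) (h : 'cV[A]_(rk F i)) : Prop :=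
  col_in I (diff F i *m h).

Definition coboundary (A : comNzRingType) (J I : A -> Prop)
    (F : free_resolution J) (i : nat) : 'cV[A]_(rk F i) -> Prop :=
  match i with
  | 0 => fun h => col_in I h
  | j.+1 => fun h => exists g : 'cV[A]_(rk F j), col_in I (h - diff F j *m g)
  end.

(* The dimension over K of Ext^i(S / J, S / I), where S = K[X_0, ..., X_(n-1)]:
   the i-th cohomology of Hom(F, S / I), for a free resolution F of S / J,
   has a K-basis with k elements. *)
Definition ext_dim (K : fieldType) (n : nat) (J I : {mpoly K[n]} -> Prop)
    (i k : nat) : Prop :=
  exists (F : free_resolution J) (b : 'I_k -> 'cV[{mpoly K[n]}]_(rk F i)),
    (forall t, cocycle I (b t)) /\
    (forall h, cocycle I h -> exists! c : {ffun 'I_k -> K},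
       coboundary I (h - \sum_t (c t)%:MP_[n] *: b t)).

Definition vars_ideal (K : fieldType) (n : nat) : {mpoly K[n]} -> Prop :=
  ideal_gen (fun f => exists i, f = 'X_i).
Arguments vars_ideal K n f : clear implicits.

Definition homogeneous (K : fieldType) (n : nat) (I : {mpoly K[n]} -> Prop) :=
  forall f k, I f -> I (pihomog mdeg k f).

(* I is a homogeneous ideal, S / I is Cohen-Macaulay, and its type is k. *)
Definition cm_type (K : fieldType) (n : nat) (I : {mpoly K[n]} -> Prop)
    (k : nat) : Prop :=
  homogeneous I /\
  exists m, [/\ krull_dim I m, depth (vars_ideal K n) I m
              & ext_dim (vars_ideal K n) I m k].

End CommutativeAlgebra.

Definition has_card (A : eqType) (P : A -> Prop) (k : nat) : Prop :=
  exists s : seq A, [/\ uniq s, size s = k & forall x, x \in s <-> P x].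

(* A graph on the finite type T is a symmetric irreflexive relation g.
   The values of a weight function off the edges are never used. *)
Section Graphs.
Variables (T : finType) (g : rel T).

Definition edge_weighting (w : T -> T -> nat) : Prop :=
  forall u v, g u v -> 0 < w u v /\ w u v = w v u.

Definition is_path (r : nat) (Q : r.+1.-tuple T) : bool :=
  uniq Q && sorted g Q.

(* e_Q(u); [zip Q (behead Q)] lists the edges of Q. *)
Definition path_weight (w : T -> T -> nat) (Q : seq T) (u : T) : nat :=
  \max_(p <- zip Q (behead Q) | (u == p.1) || (u == p.2)) w p.1 p.2.

Definition path_cover (r : nat) (A : {set T}) : bool :=
  [forall Q : r.+1.-tuple T, is_path Q ==> [exists u in A, u \in Q]].

(* A pair (V', delta') with delta' : V' -> {1, 2, ...} is encoded as the
   function equal to delta' on V' and to 0 off V'. *)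
Definition supp (c : {ffun T -> nat}) : {set T} := [set u | 0 < c u].

Definition wpath_cover (w : T -> T -> nat) (r : nat) (c : {ffun T -> nat}) :
    Prop :=
  path_cover r (supp c) /\
  forall Q : r.+1.-tuple T, is_path Q ->
    exists u, [/\ u \in Q, u \in supp c & c u <= path_weight w Q u].

Definition cover_le (c2 c1 : {ffun T -> nat}) : Prop :=
  supp c2 \subset supp c1 /\ forall u, u \in supp c2 -> c1 u <= c2 u.

Definition min_wpath_cover (w : T -> T -> nat) (r : nat)
    (c : {ffun T -> nat}) : Prop :=
  wpath_cover w r c /\
  forall c', wpath_cover w r c' -> cover_le c' c -> c' = c.

Definition min_vertex_covers : {set {set T}} :=
  [set A | minset (path_cover 1) A].

Section Ideals.
Variable K : fieldType.
Local Open Scope ring_scope.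

Definition vvar (u : T) : {mpoly K[#|T|]} := 'X_(enum_rank u).

Definition wpath_ideal (w : T -> T -> nat) (r : nat) :
    {mpoly K[#|T|]} -> Prop :=
  ideal_gen (fun f => exists2 Q : r.+1.-tuple T, is_path Q &
    f = \prod_(u <- Q) vvar u ^+ path_weight w Q u).

Definition path_ideal (r : nat) : {mpoly K[#|T|]} -> Prop :=
  ideal_gen (fun f => exists2 Q : r.+1.-tuple T, is_path Q &
    f = \prod_(u <- Q) vvar u).

Definition edge_ideal : {mpoly K[#|T|]} -> Prop :=
  ideal_gen (fun f => exists u v, g u v /\ f = vvar u * vvar v).

End Ideals.
End Graphs.

Arguments wpath_ideal {T} g K w r f.
Arguments path_ideal {T} g K r f.
Arguments edge_ideal {T} g K f.

Definition unit_weight (T : Type) (u v : T) : nat := 1.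

Section Suspensions.
Variables (d : nat) (e : rel 'I_d).

(* The vertex v_(i,j) of the s-path suspension is the pair (i, j). *)
Definition susp (s : nat) : rel ('I_d * 'I_s.+1) := fun u v =>
  [&& u.2 == ord0, v.2 == ord0 & e u.1 v.1] ||
  (u.1 == v.1) && ((v.2 == u.2.+1 :> nat) || (u.2 == v.2.+1 :> nat)).

Definition susp_weighting (om : 'I_d -> 'I_d -> nat) (s : nat)
    (la : 'I_d * 'I_s.+1 -> 'I_d * 'I_s.+1 -> nat) : Prop :=
  edge_weighting (@susp s) la /\
  forall i j, e i j -> la (i, ord0) (j, ord0) = om i j.

(* Meaningful for s >= 1, when [inord 1] is the index 1. *)
Definition susp_bounded (s : nat)
    (la : 'I_d * 'I_s.+1 -> 'I_d * 'I_s.+1 -> nat) : Prop :=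
  forall i j, e i j ->
    la (i, ord0) (j, ord0) <= la (i, ord0) (i, inord 1) /\
    la (i, ord0) (j, ord0) <= la (j, ord0) (j, inord 1).

Section PMinimal.
Variables (s : nat) (mu : 'I_d * 'I_s.+1 -> 'I_d * 'I_s.+1 -> nat).

Definition max_weight (u : 'I_d * 'I_s.+1) : nat :=
  \max_(v | susp u v) mu u v.

Definition col_supp (c : {ffun 'I_d * 'I_s.+1 -> nat}) : {set 'I_d} :=
  [set u.1 | u in supp c].

(* In [option nat], [None] stands for infinity. *)
Definition omin (a b : option nat) : option nat :=
  match a, b with
  | Some x, Some y => Some (minn x y)
  | None, _ => b
  | _, None => a
  end.

Definition ole (a b : option nat) : bool :=
  match a, b with
  | Some x, Some y => x <= y
  | _, None => true
  | None, Some _ => false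
  end.

Definition gamma (c : {ffun 'I_d * 'I_s.+1 -> nat}) (i : 'I_d) : option nat :=
  \big[omin/None]_(j : 'I_s.+1
      | ((i, j) \in supp c) && (c (i, j) <= max_weight (i, j)))
    Some (c (i, j) + \sum_(k : 'I_s.+1 | k < j) max_weight (i, k)).

Definition p_le (c1 c2 : {ffun 'I_d * 'I_s.+1 -> nat}) : Prop :=
  col_supp c1 \subset col_supp c2 /\
  forall i, i \in col_supp c1 -> ole (gamma c2 i) (gamma c1 i).

(* The covers are by s.+1-paths of the s-path suspension. *)
Definition p_minimal (c : {ffun 'I_d * 'I_s.+1 -> nat}) : Prop :=
  min_wpath_cover (@susp s) mu s.+1 c /\
  ~ exists c', [/\ min_wpath_cover (@susp s) mu s.+1 c', p_le c' c
                 & ~ p_le c c'].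

End PMinimal.
End Suspensions.

(* Main.v *)
From HB Require Import structures.
Require Import Defs.
From mathcomp Require Import mpoly.
From mathcomp Require Import all_boot all_order all_algebra.
From Stdlib Require Import FunctionalExtensionality PropExtensionality.

Set Implicit Arguments.
Unset Strict Implicit.
Unset Printing Implicit Defensive.

Import GRing.Theory.

(** All the ideals concerned are generated by monomials in variables [X_(i,j)]
    arranged in [d] columns, and these monomials fill the columns from the
    bottom: a generator that involves [X_(i,j)] carries every [X_(i,j')] with
    [j' < j] to the largest exponent that occurs anywhere. For an unweighted path
    this is because a path of length [r] cannot be contained in the end of a
    column and hence meets a column in an initial segment ([path_down]); for
    weighted edges it is the assumption that no edge at a vertex is heavier than
    the pendant one.

    For such an ideal [I] the differences [X_(i,j) - X_(i,0)] form a regular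
    sequence modulo [I] ([mideal_nzd], [weakly_regular_columns]). Dividing by
    them identifies the variables of each column and leaves a monomial ideal of
    [K[X_0, ..., X_(d-1)]], which contains a power of every variable because each
    column has a generator of its own. So [R' / I] is Cohen-Macaulay of dimension
    [d * r], and its type is the dimension of the socle of the Artinian quotient.
    The socle is spanned by the monomials outside the ideal all of whose
    multiples by a variable lie inside ([corner]). Their exponent vectors are the
    maximal ones outside the ideal ([corner_max]); an exponent vector [a] outside
    the ideal says that each generator exceeds [a] in some column, that is, that
    [a] is a cover, and a larger vector is a smaller cover. This gives minimal
    covers for weighted edges ([min_edge_coverE]) and [p]-minimal covers for
    paths ([p_minimalE]).

    The Ext module is computed from a Koszul complex, built as an iterated mapping
    cone. A nonzerodivisor on the target shifts the only known cohomology module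
    by one degree and divides it ([ext_iso_regular]); each of the remaining
    variables [X_(i,0)] restricts it to its annihilator ([ext_iso_socle]).

    The upper bounds for the Krull dimension and for the depth have a common
    source. There are few monomials of bounded degree outside [I], so any
    [d * r + 1] polynomials satisfy a polynomial relation modulo [I]
    ([growth_relation]); along a chain of primes, as along a regular sequence, such
    a relation can be simplified term by term until it says that 1 belongs to the
    last ideal ([collapse]). *)

(** * Ideals and regular sequences *)

Section Ideals.
Local Open Scope ring_scope.
Variable A : comNzRingType.
Implicit Types (I G : A -> Prop) (f g y : A) (s : seq A).

Definition is_ideal I :=
  [/\ I 0, forall f g, I f -> I g -> I (f + g) & forall a f, I f -> I (a * f)].

Definition zero_ideal f : Prop := f = 0.

Lemma is_idealN I f : is_ideal I -> I f -> I (- f).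
Proof. by case=> _ _ IM If; rewrite -mulN1r; apply: IM. Qed.

Lemma is_idealB I f g : is_ideal I -> I f -> I g -> I (f - g).
Proof. by move=> II If Ig; case: (II) => _ ID _; apply: ID => //; apply: is_idealN. Qed.

Lemma is_idealBC I f g : is_ideal I -> I (f - g) -> I (g - f).
Proof. by move=> II /(is_idealN II); rewrite opprB. Qed.

Lemma is_ideal_trans I f g h :
  is_ideal I -> I (f - g) -> I (g - h) -> I (f - h).
Proof. by move=> II H1 H2; case: (II) => _ ID _; rewrite -(subrKA g); apply: ID. Qed.

Lemma is_ideal_congr I f g : is_ideal I -> I (f - g) -> I f <-> I g.
Proof.
move=> II Ifg; case: (II) => _ ID _; split=> H.
  by rewrite -(subKr f g); apply: is_idealB.
by rewrite -(subrK g f); apply: ID.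
Qed.

Lemma is_ideal_sum I (T : Type) (r : seq T) (P : pred T) F :
  is_ideal I -> (forall t, P t -> I (F t)) -> I (\sum_(t <- r | P t) F t).
Proof. by case=> I0 ID _ IF; apply: big_ind. Qed.

Lemma ideal_gen_ideal G : is_ideal (ideal_gen G).
Proof.
split.
- by exists [::]; split=> //; rewrite big_nil.
- move=> f g [s1 [G1 ->]] [s2 [G2 ->]]; exists (s1 ++ s2); rewrite big_cat.
  by split=> // p; rewrite mem_cat => /orP[/G1|/G2].
move=> a f [s [Gs ->]]; exists [seq (a * p.1, p.2) | p <- s]; split.
  by move=> _ /mapP[p /Gs Gp ->].
by rewrite big_map mulr_sumr; apply: eq_bigr => p _; rewrite mulrA.
Qed.

Lemma ideal_gen_incl G f : G f -> ideal_gen G f.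
Proof.
move=> Gf; exists [:: (1, f)]; rewrite big_seq1 mul1r; split=> //.
by move=> p; rewrite inE => /eqP->.
Qed.

Lemma ideal_gen_min G I f :
  is_ideal I -> (forall g, G g -> I g) -> ideal_gen G f -> I f.
Proof.
move=> II GI [s [Gs ->]]; rewrite big_seq; apply: is_ideal_sum => // p sp.
by case: II => _ _; apply; apply/GI/Gs.
Qed.

(** With [take i s] for [s], this is the ideal that occurs in the definition of
    regular sequences. *)
Definition add_gens I s : A -> Prop := ideal_gen (fun f => I f \/ f \in s).

Lemma add_gens_ideal I s : is_ideal (add_gens I s).
Proof. exact: ideal_gen_ideal. Qed.

Lemma add_gens_nil I f : is_ideal I -> add_gens I [::] f <-> I f.
Proof.
move=> II; split; last by move=> ?; apply: ideal_gen_incl; left.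
by apply: ideal_gen_min => // g [].
Qed.

Lemma add_gens_rcons I s y f :
  add_gens I (rcons s y) f <-> exists c, add_gens I s (f - y * c).
Proof.
split.
  apply: (ideal_gen_min (I := fun f => exists c, add_gens I s (f - y * c))).
    have [A0 AD AM] := add_gens_ideal I s; split.
    - by exists 0; rewrite mulr0 subr0.
    - by move=> g h [c Hc] [c' Hc']; exists (c + c'); rewrite mulrDr opprD addrACA;
      apply: AD.
    - by move=> a g [c Hc]; exists (a * c); rewrite mulrCA -mulrBr; apply: AM.
  move=> g [Ig|]; first by exists 0; rewrite mulr0 subr0; apply: ideal_gen_incl; left.
  rewrite mem_rcons inE => /orP[/eqP->|sg].
    by exists 1; rewrite mulr1 subrr; case: (add_gens_ideal I s).
  by exists 0; rewrite mulr0 subr0; apply: ideal_gen_incl; right.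
case=> c Hc; have [_ AD AM] := add_gens_ideal I (rcons s y).
rewrite -(subrK (y * c) f); apply: AD.
  apply: ideal_gen_min Hc; first exact: add_gens_ideal.
  by move=> g [Ig|sg]; apply: ideal_gen_incl; [left | right;
    rewrite mem_rcons inE sg orbT].
by rewrite mulrC; apply/AM/ideal_gen_incl; right; rewrite mem_rcons inE eqxx.
Qed.

Definition nonzerodivisor I y := forall f, I (y * f) -> I f.

(** Regularity without the requirement that the final quotient be nonzero: a
    property of all initial segments, suited to induction on the last element. *)
Definition weakly_regular I s := forall i f, (i < size s)%N ->
  add_gens I (take i s) (s`_i * f) -> add_gens I (take i s) f.

Lemma weakly_regular_rcons I s y :
  weakly_regular I (rcons s y) <->
  weakly_regular I s /\ nonzerodivisor (add_gens I s) y.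
Proof.
have take_rcons i : (i <= size s)%N -> take i (rcons s y) = take i s.
  by move=> le_is; rewrite -cats1 takel_cat.
split=> [reg|[reg nzd] i f].
  split=> [i f lt_is | f].
    have := reg i f; rewrite size_rcons ltnS nth_rcons lt_is take_rcons 1?ltnW //.
    by move=> H; exact: H.
  have := reg (size s) f; rewrite size_rcons nth_rcons ltnn eqxx take_rcons // take_size.
  by move=> H; exact: H.
rewrite size_rcons ltnS nth_rcons leq_eqVlt => /orP[/eqP->|lt_is].
  by rewrite ltnn eqxx take_rcons // take_size; exact: nzd.
by rewrite lt_is take_rcons 1?ltnW //; exact: reg.
Qed.

End Ideals.

(** * Mapping cones and the cohomology of a Koszul resolution *)

Section Cone.
Local Open Scope ring_scope.
Variable A : comNzRingType.

Section Columns.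
Variable I : A -> Prop.
Hypothesis I_ideal : is_ideal I.

Lemma col_inD b (h k : 'cV[A]_b) : col_in I h -> col_in I k -> col_in I (h + k).
Proof. by move=> Hh Hk t; rewrite mxE; case: I_ideal => _ ID _; apply: ID. Qed.

Lemma col_inN b (h : 'cV[A]_b) : col_in I h -> col_in I (- h).
Proof. by move=> Hh t; rewrite mxE; apply: is_idealN. Qed.

Lemma col_inB b (h k : 'cV[A]_b) : col_in I h -> col_in I k -> col_in I (h - k).
Proof. by move=> Hh Hk; apply: col_inD => //; apply: col_inN. Qed.

Lemma col_inZ b a (h : 'cV[A]_b) : col_in I h -> col_in I (a *: h).
Proof. by move=> Hh t; rewrite mxE; case: I_ideal => _ _; apply. Qed.

Lemma col_inM b c (M : 'M[A]_(c, b)) (h : 'cV[A]_b) :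
  col_in I h -> col_in I (M *m h).
Proof.
by move=> Hh t; rewrite mxE; apply: is_ideal_sum => // j _; case: I_ideal => _ _; apply.
Qed.

Lemma col_in0 b : col_in I (0 : 'cV[A]_b).
Proof. by move=> t; rewrite mxE; case: I_ideal. Qed.

Lemma col_in_col b c (h : 'cV[A]_b) (k : 'cV[A]_c) :
  col_in I (col_mx h k) <-> col_in I h /\ col_in I k.
Proof.
split=> [H|[Hh Hk] t]; last by rewrite mxE; case: splitP.
by split=> t; [have := H (lshift _ t) | have := H (rshift _ t)];
  rewrite ?col_mxEu ?col_mxEd.
Qed.

Lemma col_in_rk0 b (h : 'cV[A]_b) : b = 0%N -> col_in I h.
Proof. by move=> b0; subst b; case. Qed.

End Columns.

Section Differentials.
Variables (J : A -> Prop) (F : free_resolution J).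

(** The module and the map of the resolution shifted by one, with the zero
    module in degree 0; they make the cone formulas uniform in the degree. *)
Definition rk_pred i := if i is j.+1 then rk F j else 0%N.

Definition diff_pred i : 'M[A]_(rk F i, rk_pred i) :=
  match i with 0%N => 0 | j.+1 => diff F j end.

Lemma coboundaryE I i (h : 'cV[A]_(rk F i)) :
  coboundary I h <-> exists g : 'cV[A]_(rk_pred i), col_in I (h - diff_pred i *m g).
Proof.
case: i h => [|i] h //=; split=> [Hh|[g]]; last by rewrite mul0mx subr0.
by exists 0; rewrite mulmx0 subr0.
Qed.

Lemma diff_diff_pred i : diff F i *m diff_pred i = 0.
Proof.
case: i => [|i] /=; first by rewrite mulmx0.
apply/row_matrixP => k; rewrite row_mul row0.
by apply/exact_diff; exists (row k 1%:M); rewrite -row_mul mul1mx.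
Qed.

End Differentials.

(** The mapping cone of multiplication by [y] on a free resolution of [A / J]:
    it resolves [A / (J + (y))] when [y] is a nonzerodivisor on [A / J]. *)
Section MappingCone.
Variables (J J' : A -> Prop) (y : A) (F : free_resolution J).
Hypotheses (J_ideal : is_ideal J) (y_nzd : nonzerodivisor J y).
Hypothesis J'E : forall f, J' f <-> exists c, J (f - y * c).

Definition cone_rk i := (rk F i + rk_pred F i)%N.

Definition cone_aug : 'cV[A]_(cone_rk 0) := col_mx (aug F) 0.

Definition cone_diff i : 'M[A]_(cone_rk i.+1, cone_rk i) :=
  block_mx (diff F i) 0 (y%:M : 'M_(rk_pred F i.+1, rk F i)) (- diff_pred F i).

Lemma cone_aug_mul (u : 'rV[A]_(cone_rk 0)) :
  (u *m cone_aug) 0 0 = (lsubmx u *m aug F) 0 0.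
Proof. by rewrite -{1}(hsubmxK u) mul_row_col mulmx0 addr0. Qed.

Lemma cone_diff_mul i (u : 'rV[A]_(rk F i.+1)) (v : 'rV[A]_(rk F i)) :
  row_mx u v *m cone_diff i =
    row_mx (u *m diff F i + y *: v) (- (v *m diff_pred F i)).
Proof.
by rewrite /cone_diff mul_row_block mulmx0 add0r mulmxN mul_mx_scalar.
Qed.

Lemma aug_diff (v : 'rV[A]_(rk F 1)) : J ((v *m diff F 0 *m aug F) 0 0).
Proof. by apply/exact_aug; exists v. Qed.

Lemma cone_aug_surj a : exists u : 'rV[A]_(cone_rk 0), J' ((u *m cone_aug) 0 0 - a).
Proof.
have [u Hu] := aug_surj F a; exists (row_mx u 0).
by rewrite cone_aug_mul row_mxKl; apply/J'E; exists 0; rewrite mulr0 subr0.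
Qed.

Lemma cone_exact_aug (u : 'rV[A]_(cone_rk 0)) :
  J' ((u *m cone_aug) 0 0) <-> exists v : 'rV[A]_(cone_rk 1), u = v *m cone_diff 0.
Proof.
rewrite cone_aug_mul J'E; split.
  case=> c Hc; have [w Hw] := aug_surj F c.
  have : J (((lsubmx u - y *: w) *m aug F) 0 0).
    rewrite mulmxBl -scalemxAl.
    move: (_ *m aug F) (w *m aug F) Hc Hw => p q Hc Hw; rewrite !mxE.
    apply: is_ideal_trans Hc _ => //; rewrite -mulrBr.
    by case: J_ideal => _ _; apply; apply: is_idealBC.
  case/exact_aug=> v Hv; exists (row_mx v w).
  rewrite cone_diff_mul -[LHS]hsubmxK; congr row_mx; last by apply/rowP; case.
  by rewrite -Hv subrK.
case=> v ->; rewrite -(hsubmxK v) cone_diff_mul row_mxKl mulmxDl -scalemxAl.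
exists ((rsubmx v *m aug F) 0 0); have := aug_diff (lsubmx v).
by move: (_ *m aug F) (_ *m aug F) => p q; rewrite !mxE addrK.
Qed.

Lemma cone_exact_diff i (u : 'rV[A]_(cone_rk i.+1)) :
  u *m cone_diff i = 0 <-> exists v : 'rV[A]_(cone_rk i.+2), u = v *m cone_diff i.+1.
Proof.
split; last first.
  case=> v ->; rewrite -(hsubmxK v) cone_diff_mul /= cone_diff_mul.
  rewrite mulmxDl -mulmxA -scalemxAl scalerN addrK mulNmx -mulmxA.
  have /= -> := diff_diff_pred F i.+1; have /= -> := diff_diff_pred F i.
  by rewrite !mulmx0 !oppr0 row_mx0.
rewrite -(hsubmxK u); move: (lsubmx u) (rsubmx u) => {u} u v /=.
rewrite cone_diff_mul -row_mx0 => /eq_row_mx[eq_u eq_v].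
(* in degree 0 exactness of the second component is the regularity of [y] *)
have [w Hw] : exists w : 'rV[A]_(rk F i.+1), v = w *m diff F i.
  case: i u v eq_u eq_v => [|i] u v eq_u eq_v; last first.
    by apply/exact_diff; move/eqP: eq_v; rewrite oppr_eq0 => /eqP.
  apply/exact_aug/y_nzd.
  have -> : y * (v *m aug F) 0 0 = - ((u *m diff F 0 *m aug F) 0 0).
    by move/eqP: eq_u; rewrite addr_eq0 => /eqP->; rewrite mulNmx -scalemxAl;
      move: (v *m aug F) => q; rewrite !mxE opprK.
  by apply: is_idealN => //; apply: aug_diff.
have : (u + y *: w) *m diff F i = 0 by rewrite mulmxDl -scalemxAl -Hw.
case/exact_diff=> a Ha; exists (row_mx a (- w)).
by rewrite cone_diff_mul /= -Ha scalerN addrK mulNmx opprK Hw.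
Qed.

Definition cone : free_resolution J' :=
  FreeResolution cone_aug_surj cone_exact_aug cone_exact_diff.

Section Cohomology.
Variable I : A -> Prop.
Hypothesis I_ideal : is_ideal I.

Lemma cone_cocycle i (h : 'cV[A]_(rk F i)) (g : 'cV[A]_(rk_pred F i)) :
  cocycle (F := cone) (i := i) I (col_mx h g) <->
  cocycle I h /\ col_in I (y *: h - diff_pred F i *m g).
Proof.
rewrite /cocycle /= /cone_diff mul_block_col mul0mx addr0 mul_scalar_mx mulNmx.
exact: col_in_col.
Qed.

Lemma cone_coboundary i (h : 'cV[A]_(rk F i.+1)) (g : 'cV[A]_(rk F i)) :
  coboundary (F := cone) (i := i.+1) I (col_mx h g) <->
  exists (k : 'cV[A]_(rk F i)) (l : 'cV[A]_(rk_pred F i)),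
    col_in I (h - diff F i *m k) /\ col_in I (g - (y *: k - diff_pred F i *m l)).
Proof.
rewrite /=; split.
  case=> k; rewrite -(vsubmxK k) /cone_diff mul_block_col mul0mx addr0.
  rewrite mul_scalar_mx mulNmx opp_col_mx add_col_mx => /col_in_col H.
  by exists (usubmx k), (dsubmx k).
case=> k [l /col_in_col H]; exists (col_mx k l).
by rewrite /cone_diff mul_block_col mul0mx addr0 mul_scalar_mx mulNmx opp_col_mx
  add_col_mx.
Qed.

Lemma cone_coboundary_fst i (h : 'cV[A]_(rk F i)) (g : 'cV[A]_(rk_pred F i)) :
  coboundary (F := cone) (i := i) I (col_mx h g) -> coboundary I h.
Proof.
case: i h g => [|i] h g; first by case/col_in_col.
by case/cone_coboundary=> k [l []]; exists k.
Qed.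

(** If [h] is the coboundary of [k], then [y *: k - g] is a cocycle of [F] one
    degree lower; once this bounds too, so does the pair [(h, g)]. *)
Lemma cone_coboundary_lift i (h : 'cV[A]_(rk F i)) (g : 'cV[A]_(rk_pred F i)) :
  (forall j, i = j.+1 -> forall k : 'cV[A]_(rk F j), cocycle I k -> coboundary I k) ->
  cocycle (F := cone) (i := i) I (col_mx h g) -> coboundary I h ->
  coboundary (F := cone) (i := i) I (col_mx h g).
Proof.
move=> vanish /cone_cocycle[_ Hg].
case: i h g vanish Hg => [|i] h g vanish Hg.
  by move=> Hh; apply/col_in_col; split=> //; apply: col_in_rk0.
case=> k Hk; apply/cone_coboundary; exists k.
have : cocycle I (y *: k - g).
  have /= H := col_inD I_ideal (col_inN I_ideal (col_inZ I_ideal y Hk)) Hg.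
  by move: H; rewrite /cocycle scalerBr opprB addrA subrK mulmxBr -scalemxAr.
case/(vanish i erefl)/coboundaryE=> l Hl; exists l; split=> //.
by have := col_inN I_ideal Hl; rewrite !opprB addrCA.
Qed.

End Cohomology.
End MappingCone.

(** [H^i(Hom(F, A / I))] vanishes for [i < p], and [H^p] is isomorphic to
    [Z / B]. The isomorphism is given by a row vector [pr], so that it is linear
    by construction and quotient modules need not be formed. *)
Definition ext_iso (J I : A -> Prop) (F : free_resolution J) p (Z B : A -> Prop) :=
  (forall i, (i < p)%N -> forall h : 'cV[A]_(rk F i), cocycle I h -> coboundary I h) /\
  exists pr : 'rV[A]_(rk F p),
    [/\ forall h, cocycle I h -> Z ((pr *m h) 0 0),
        forall c, Z c -> exists2 h, cocycle I h & (pr *m h) 0 0 = c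
      & forall h, cocycle I h -> (coboundary I h <-> B ((pr *m h) 0 0))].

Section Koszul.
Variable I : A -> Prop.
Hypothesis I_ideal : is_ideal I.

Lemma cone_lower_vanish (J J' : A -> Prop) y (F : free_resolution J)
    (J_ideal : is_ideal J) (y_nzd : nonzerodivisor J y)
    (J'E : forall f, J' f <-> exists c, J (f - y * c)) p :
  (forall i, (i < p)%N -> forall h : 'cV[A]_(rk F i), cocycle I h -> coboundary I h) ->
  forall i, (i < p)%N ->
  forall h : 'cV[A]_(rk (cone F J_ideal y_nzd J'E) i), cocycle I h -> coboundary I h.
Proof.
move=> vanish i lt_ip h; rewrite -(vsubmxK h) => Hh.
apply: cone_coboundary_lift => // [j def_i k|].
  by apply: vanish; apply: ltnW; rewrite -def_i.
by apply: vanish => //; case/cone_cocycle: Hh.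
Qed.

(** In the long exact sequence of the cone, multiplication by [y] is injective on
    [H^p = A / B], so [H^p] of the cone vanishes and [H^(p+1)] is the cokernel
    [A / (B + (y))], because [H^(p+1)] of [F] is zero. *)
Lemma ext_iso_regular (J J' B : A -> Prop) y (F : free_resolution J) p
    (J_ideal : is_ideal J) (y_nzd : nonzerodivisor J y)
    (J'E : forall f, J' f <-> exists c, J (f - y * c)) :
  nonzerodivisor B y -> (forall i, (p < i)%N -> rk F i = 0%N) ->
  ext_iso I F p (fun=> True) B ->
  ext_iso I (cone F J_ideal y_nzd J'E) p.+1 (fun=> True)
    (fun f => exists c, B (f - y * c)).
Proof.
move=> B_nzd rk0 [vanish [pr [_ pr_surj prB]]].
have top_cocycle (h : 'cV_(rk F p)) : cocycle I h by apply: col_in_rk0; rewrite rk0.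
split=> [i|].
  rewrite ltnS leq_eqVlt => /orP[/eqP-> h|lt_ip]; last first.
    by move=> h Hh; exact: (cone_lower_vanish vanish lt_ip Hh).
  rewrite -(vsubmxK h) => Hh; apply: cone_coboundary_lift => //.
    by move=> j def_p; apply: vanish; rewrite def_p.
  have /cone_cocycle[Hu Hc] := Hh; apply/prB => //; apply: B_nzd.
  have : coboundary I (y *: usubmx h) by apply/coboundaryE; exists (dsubmx h).
  by move/prB => /(_ (top_cocycle _)); rewrite -scalemxAr mxE.
exists (row_mx 0 pr); split=> // [c _|h _].
  have [g _ Hg] := pr_surj c Logic.I; exists (col_mx 0 g).
    by apply/cone_cocycle; split; apply: col_in_rk0; rewrite ?rk0.
  by rewrite mul_row_col mul0mx add0r.
rewrite -(vsubmxK h) mul_row_col mul0mx add0r; split.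
  case/cone_coboundary=> k [l [_ Hl]]; exists ((pr *m k) 0 0).
  have /prB : coboundary I (dsubmx h - y *: k).
    by apply/coboundaryE; exists (- l); rewrite mulmxN opprK;
      rewrite opprB addrA addrAC in Hl.
  by move/(_ (top_cocycle _)); rewrite mulmxBr -scalemxAr;
    move: (pr *m _) (pr *m _) => q q'; rewrite !mxE.
case=> c; have [k _ <-] := pr_surj c Logic.I => Hc.
have : coboundary I (dsubmx h - y *: k).
  apply/prB => //; rewrite mulmxBr -scalemxAr.
  by move: (pr *m _) (pr *m _) Hc => q q'; rewrite !mxE.
case/coboundaryE=> l Hl; apply/cone_coboundary; exists k, (- l); split.
  by apply: col_in_rk0; rewrite rk0.
by rewrite mulmxN opprK opprD addrA.
Qed.

(** In the long exact sequence of the cone, [H^p] of the cone is the kernel of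
    multiplication by [z] on [H^p], because [H^(p-1)] of [F] vanishes. *)
Lemma ext_iso_socle (J J' Z B : A -> Prop) z (F : free_resolution J) p
    (J_ideal : is_ideal J) (z_nzd : nonzerodivisor J z)
    (J'E : forall f, J' f <-> exists c, J (f - z * c)) :
  ext_iso I F p Z B ->
  ext_iso I (cone F J_ideal z_nzd J'E) p (fun f => Z f /\ B (z * f)) B.
Proof.
case=> vanish [pr [prZ pr_surj prB]]; split.
  by move=> i lt_ip h Hh; exact: (cone_lower_vanish vanish lt_ip Hh).
have mulz h : (pr *m (z *: h)) 0 0 = z * (pr *m h) 0 0.
  by rewrite -scalemxAr mxE.
have cocycleZ h : cocycle I h -> cocycle I (z *: h).
  by rewrite /cocycle -scalemxAr; apply: col_inZ.
exists (row_mx pr 0); split=> [h|c [Zc Bc]|h].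
- rewrite -(vsubmxK h) mul_row_col mul0mx addr0 => /cone_cocycle[Hu Hc].
  split; first exact: prZ.
  by rewrite -mulz; apply/prB; [apply: cocycleZ | apply/coboundaryE; exists (dsubmx h)].
- have [h Hh def_c] := pr_surj c Zc.
  have /coboundaryE[g Hg] : coboundary I (z *: h).
    by apply/prB; [apply: cocycleZ | rewrite mulz def_c].
  exists (col_mx h g); first by apply/cone_cocycle.
  by rewrite mul_row_col mul0mx addr0.
rewrite -(vsubmxK h) mul_row_col mul0mx addr0 => Hh; have /cone_cocycle[Hu _] := Hh.
split; first by move/cone_coboundary_fst/prB; apply.
by move/prB => /(_ Hu) Hb; apply: cone_coboundary_lift => // j def_p; apply: vanish;
  rewrite def_p.
Qed.

Lemma ext_iso_congr (J Z Z' B B' : A -> Prop) (F : free_resolution J) p :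
  (forall f, Z f <-> Z' f) -> (forall f, B f <-> B' f) ->
  ext_iso I F p Z B -> ext_iso I F p Z' B'.
Proof.
move=> ZZ' BB' [vanish [pr [prZ pr_surj prB]]]; split=> //; exists pr; split.
- by move=> h /prZ/ZZ'.
- by move=> c /ZZ'/pr_surj.
by move=> h Hh; rewrite prB // BB'.
Qed.

Lemma zero_ideal_ideal : is_ideal (@zero_ideal A).
Proof. by split=> [|f g -> ->|a f ->]; rewrite ?addr0 ?mulr0. Qed.

Section TrivialResolution.

Let rk0 i := (i == 0%N) : nat.
Let aug0 : 'cV[A]_(rk0 0) := 1%:M.
Let diff0 i : 'M[A]_(rk0 i.+1, rk0 i) := 0.
Let J0 := add_gens (@zero_ideal A) [::].

Let aug0_surj (a : A) : exists u : 'rV[A]_(rk0 0), J0 ((u *m aug0) 0 0 - a).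
Proof.
exists a%:M; apply/add_gens_nil; first exact: zero_ideal_ideal.
by rewrite mulmx1 mxE eqxx mulr1n subrr.
Qed.

Let exact_aug0 (u : 'rV[A]_(rk0 0)) :
  J0 ((u *m aug0) 0 0) <-> exists v : 'rV[A]_(rk0 1), u = v *m diff0 0.
Proof.
rewrite mulmx1; split=> [|[v ->]].
  move/(add_gens_nil _ zero_ideal_ideal) => Hu; exists 0.
  by rewrite mulmx0; apply/matrixP => i j; rewrite !ord1 Hu mxE.
by apply/(add_gens_nil _ zero_ideal_ideal); rewrite mulmx0 mxE.
Qed.

Let exact_diff0 i (u : 'rV[A]_(rk0 i.+1)) :
  u *m diff0 i = 0 <-> exists v : 'rV[A]_(rk0 i.+2), u = v *m diff0 i.+1.
Proof. by split=> _; [exists 0; apply/rowP; case | rewrite mulmx0]. Qed.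

Definition trivial_resolution : free_resolution J0 :=
  FreeResolution aug0_surj exact_aug0 exact_diff0.

Lemma ext_iso_trivial :
  ext_iso I trivial_resolution 0 (fun=> True) (add_gens I [::]).
Proof.
split=> //; exists 1%:M; split=> // [c _|h _].
  exists c%:M; first by apply: col_in_rk0.
  by rewrite mul1mx mxE eqxx mulr1n.
rewrite mul1mx; split=> [Hh|/(add_gens_nil _ I_ideal) Hh t].
  exact/add_gens_nil.
by rewrite (ord1 t).
Qed.

End TrivialResolution.

Lemma koszul_regular (ys : seq A) :
  weakly_regular (@zero_ideal A) ys -> weakly_regular I ys ->
  exists F : free_resolution (add_gens (@zero_ideal A) ys),
    (forall i, (size ys < i)%N -> rk F i = 0%N) /\
    ext_iso I F (size ys) (fun=> True) (add_gens I ys).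
Proof.
elim/last_ind: ys => [|ys y IH] reg0 regI.
  by exists trivial_resolution; split; [case | exact: ext_iso_trivial].
have [/IH{}IH nzd0] := (weakly_regular_rcons _ _ _).1 reg0.
have [/IH[F [rk0 isoF]] nzdI] := (weakly_regular_rcons _ _ _).1 regI.
exists (cone F (add_gens_ideal _ _) nzd0 (add_gens_rcons _ _ _)).
rewrite size_rcons; split.
  case=> // i; rewrite ltnS => lt_si.
  by rewrite /= /cone_rk /= !rk0 // ltnW.
apply: ext_iso_congr (ext_iso_regular _ _ _ nzdI rk0 isoF) => // f.
by rewrite add_gens_rcons.
Qed.

(** The Koszul complex computes the Ext of [A / (ys, zs)] against [A / I]: in
    degree [size ys] it is the part of [A / (I, ys)] annihilated by [zs]. *)
Lemma koszul_socle (ys zs : seq A) :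
  weakly_regular (@zero_ideal A) (ys ++ zs) -> weakly_regular I ys ->
  exists F : free_resolution (add_gens (@zero_ideal A) (ys ++ zs)),
    ext_iso I F (size ys) (fun f => forall z, z \in zs -> add_gens I ys (z * f))
      (add_gens I ys).
Proof.
elim/last_ind: zs => [|zs z IH] reg0 regI.
  rewrite cats0 in reg0 *; have [F [_ isoF]] := koszul_regular reg0 regI.
  by exists F; apply: ext_iso_congr isoF.
rewrite -rcons_cat in reg0 *.
have [reg1 nzd0] := (weakly_regular_rcons _ _ _).1 reg0.
have [F isoF] := IH reg1 regI.
exists (cone F (add_gens_ideal _ _) nzd0 (add_gens_rcons _ _ _)).
apply: ext_iso_congr (ext_iso_socle _ _ _ isoF) => // f; split.
  by case=> H1 H2 x; rewrite mem_rcons inE => /predU1P[->|/H1].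
move=> H; split=> [x zx|]; apply: H; rewrite mem_rcons inE ?eqxx //.
by rewrite zx orbT.
Qed.

Section ResolutionCongr.
Variables (J J' : A -> Prop) (F : free_resolution J).
Hypothesis JJ' : forall f, J f <-> J' f.

Lemma congr_aug_surj a : exists u : 'rV[A]_(rk F 0), J' ((u *m aug F) 0 0 - a).
Proof. by have [u /JJ'] := aug_surj F a; exists u. Qed.

Lemma congr_exact_aug (u : 'rV[A]_(rk F 0)) :
  J' ((u *m aug F) 0 0) <-> exists v : 'rV[A]_(rk F 1), u = v *m diff F 0.
Proof. by rewrite -JJ'; apply: exact_aug. Qed.

Definition resolution_congr : free_resolution J' :=
  FreeResolution congr_aug_surj congr_exact_aug (@exact_diff _ _ F).

End ResolutionCongr.

End Koszul.

End Cone.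

(** * Polynomial relations bound chains of primes and regular sequences *)

(** Exponent vectors of length [k] with entries below [N]. The recursive product
    separates the first exponent from the others, as [collapse] requires. *)
Fixpoint expo N k : finType :=
  if k is k'.+1 then ('I_N * expo N k')%type : finType else unit.

Lemma card_expo N k : #|expo N k| = N ^ k.
Proof. by elim: k => [|k IH]; rewrite ?card_unit // card_prod card_ord IH expnS. Qed.

Section Collapse.
Local Open Scope ring_scope.
Variable A : comNzRingType.

Fixpoint eval_expo N k (x : nat -> A) : expo N k -> A :=
  if k is k'.+1 then
    fun a : expo N k'.+1 => x 0%N ^+ a.1 * eval_expo (fun i => x i.+1) a.2
  else fun=> 1.

(** If [x_i] lies in [B (i+1)] and is a nonzerodivisor modulo [B i], then a
    polynomial relation between the [x_i] modulo [B 0], with unit coefficients,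
    collapses the chain: cancel the smallest power of [x_0] that occurs, then
    drop the remaining multiples of [x_0] by passing to [B 1], and continue. *)
Lemma collapse N k (B : nat -> A -> Prop) (x : nat -> A) (u : expo N k -> A) :
  (forall i, (i <= k)%N -> is_ideal (B i)) ->
  (forall i f, (i < k)%N -> B i f -> B i.+1 f) ->
  (forall i, (i < k)%N -> B i.+1 (x i)) ->
  (forall i, (i < k)%N -> nonzerodivisor (B i) (x i)) ->
  (forall a, u a != 0 -> exists v, v * u a = 1) -> (exists a, u a != 0) ->
  B 0%N (\sum_a u a * eval_expo x a) -> B k 1.
Proof.
elim: k B x u => [|k IH] B x u idB subB Bx nzd unit_u [a u_a].
  case: a u_a => /unit_u[v uv1]; rewrite (bigD1 tt) //= big1 => [|[]] //.
  rewrite addr0 mulr1 => Bu; rewrite -uv1.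
  by case: (idB 0%N isT) => _ _; apply.
pose P (i : 'I_N) := [exists b, u (i, b) != 0].
have Pa : P a.1 by apply/existsP; exists a.2; case: a u_a.
case: (arg_minnP (@nat_of_ord N) Pa) => i0 /existsP[b0 u_b0] min_i0.
pose q i := \sum_b u (i, b) * eval_expo (fun j => x j.+1) b.
pose rest := \sum_(i < N | (i0 < i)%N) x 0%N ^+ (i - i0.+1) * q i.
have -> : \sum_a u a * eval_expo x a = x 0%N ^+ i0 * (q i0 + x 0%N * rest).
  have -> : \sum_a u a * eval_expo x a = \sum_(i < N) x 0%N ^+ i * q i.
    transitivity (\sum_(i < N) \sum_b u (i, b) * eval_expo (k := k.+1) x (i, b)).
      by rewrite pair_bigA; apply: eq_bigr; case.
    by apply: eq_bigr => i _; rewrite mulr_sumr; apply: eq_bigr => b _; rewrite mulrCA.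
  rewrite (bigID (fun i : 'I_N => (i < i0)%N)) /= big1 ?add0r => [|i lt_i]; last first.
    rewrite /q big1 ?mulr0 // => b _; have [->|u_b] := eqVneq (u (i, b)) 0.
      by rewrite mul0r.
    by have := min_i0 i; rewrite leqNgt lt_i => /(_ _)/negP[] //; apply/existsP; exists b.
  rewrite (bigD1 i0) -?leqNgt //= mulrDr; congr (_ + _).
  rewrite !mulr_sumr; apply: eq_big => [i|i].
    by rewrite -leqNgt ltn_neqAle andbC eq_sym.
  rewrite -leqNgt => /andP[le_i neq_i]; rewrite !mulrA -exprSr -exprD subnKC //.
  by rewrite ltn_neqAle eq_sym neq_i.
have cancel_x f j : B 0%N (x 0%N ^+ j * f) -> B 0%N f.
  by elim: j => [|j IHj]; rewrite ?mul1r // exprS -mulrA => H; apply/IHj/(nzd 0%N isT).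
move=> /cancel_x/subB => /(_ isT) Bq.
apply: (IH (fun i => B i.+1) (fun i => x i.+1) (fun b => u (i0, b))).
- by move=> i le_ik; apply: idB.
- by move=> i f lt_ik; apply: subB.
- by move=> i lt_ik; apply: Bx.
- by move=> i lt_ik; apply: nzd.
- by move=> b; apply: unit_u.
- by exists b0.
rewrite -[X in B 1%N X](addrK (x 0%N * rest)).
have id1 : is_ideal (B 1%N) by apply: idB.
apply: is_idealB => //; rewrite mulrC.
by case: id1 => _ _; apply; apply: Bx.
Qed.

End Collapse.

(** * Monomial ideals *)

Section MonomialIdeals.
Local Open Scope ring_scope.
Variables (K : fieldType) (n : nat).
Implicit Types (G : seq 'X_{1..n}) (m w : 'X_{1..n}) (f g : {mpoly K[n]}).

Definition mon_in G m := has (fun w => (w <= m)%MM) G.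

Definition mideal G f : bool := all (mon_in G) (msupp f).

Lemma mon_inP G m : reflect (exists2 w, w \in G & (w <= m)%MM) (mon_in G m).
Proof. exact: hasP. Qed.

Lemma mon_in_le G m w : (m <= w)%MM -> mon_in G m -> mon_in G w.
Proof. by move=> le_mw /mon_inP[g Gg le_gm]; apply/mon_inP; exists g => //;
  apply: lepm_trans le_mw. Qed.

Lemma midealP G f :
  reflect (forall m, ~~ mon_in G m -> f@_m = 0) (mideal G f).
Proof.
apply: (iffP allP) => H m; last by rewrite mcoeff_msupp; apply: contraR => /H->.
by apply: contraNeq; rewrite -mcoeff_msupp => /H.
Qed.

Lemma mideal_is_ideal G : is_ideal (mideal G).
Proof.
split.
- by apply/midealP => m _; rewrite mcoeff0.
- by move=> f g /midealP Hf /midealP Hg; apply/midealP => m Gm;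
  rewrite mcoeffD Hf ?Hg ?addr0.
move=> a f /allP Hf; apply/allP => m /msuppM_le/allpairsP[[m1 m2] /= [_ /Hf G2 ->]].
by apply: mon_in_le G2; apply: lem_addl.
Qed.

Lemma mideal_mpolyX G m : mideal G 'X_[m] = mon_in G m.
Proof. by rewrite /mideal msuppX /= andbT. Qed.

Lemma is_ideal_msupp (I : {mpoly K[n]} -> Prop) f :
  is_ideal I -> (forall m, m \in msupp f -> I 'X_[m]) -> I f.
Proof.
move=> II H; rewrite (mpolyE f) big_seq; apply: is_ideal_sum => // m /H Im.
by rewrite -mul_mpolyC; case: II => _ _; apply.
Qed.

Lemma mideal_min G (I : {mpoly K[n]} -> Prop) f :
  is_ideal I -> (forall w, w \in G -> I 'X_[w]) -> mideal G f -> I f.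
Proof.
move=> II GI /allP Gf; apply: is_ideal_msupp => // m /Gf/mon_inP[g /GI Ig le_gm].
by rewrite -(submK le_gm) mpolyXD; case: II => _ _; apply.
Qed.

Lemma mideal_gen G f :
  ideal_gen (fun f => exists2 w, w \in G & f = 'X_[w]) f <-> mideal G f.
Proof.
split; last first.
  apply: mideal_min; first exact: ideal_gen_ideal.
  by move=> g Gg; apply: ideal_gen_incl; exists g.
apply: (ideal_gen_min (I := fun f => mideal G f)); first exact: mideal_is_ideal.
by move=> _ [g Gg ->]; rewrite mideal_mpolyX; apply/mon_inP; exists g => //;
  apply: lepm_refl.
Qed.

Lemma mideal_homogeneous G : homogeneous (mideal G).
Proof.
move=> f k /allP Gf; rewrite /pihomog big_seq_cond.
apply: (is_ideal_sum (I := fun f => mideal G f)); first exact: mideal_is_ideal.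
move=> m /andP[/Gf Gm _].
rewrite -mul_mpolyC; case: (mideal_is_ideal G) => _ _; apply.
by rewrite mideal_mpolyX.
Qed.

Lemma mcoeffXM (i : 'I_n) m f : ('X_i * f)@_(m + U_(i)) = f@_m.
Proof. by rewrite mulrC addmC mcoeffMX. Qed.

(** A coefficient of [(X_i - X_j) * f] is the difference of the coefficients of
    [f] at [m] and at [m * X_i / X_j], so its vanishing moves along such quotients. *)
Lemma mcoeff_binomialM (i j : 'I_n) m f : i != j ->
  (('X_i - 'X_j) * f)@_(m + U_(i)) = 0 ->
  f@_m = if m j == 0%N then 0 else f@_(m + U_(i) - U_(j)).
Proof.
move=> neq_ij /eqP; rewrite mulrBl mcoeffB subr_eq0 mcoeffXM => /eqP->.
have [mj0|mj] := eqVneq (m j) 0%N.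
  apply: memN_msupp_eq0; rewrite mulrC (perm_mem (msuppMX _ _)).
  apply/mapP => -[w _ /mnmP/(_ j)]; rewrite !mnmDE !mnm1E eqxx mj0 (negPf neq_ij).
  by [].
by rewrite -{1}(@submK _ U_(j) (m + U_(i))) ?mcoeffXM // lep1mP mnmDE addn_eq0 (negPf mj).
Qed.

(** If [(X_a - X_b) * f] lies in the ideal, a monomial of [f] outside the ideal can
    be multiplied by [X_b / X_a] or by [X_a / X_b], according to whether its
    exponent of [X_b] reaches [c]; it remains a monomial of [f] outside the ideal,
    and this goes on until an exponent is used up. *)
Lemma mideal_nzd G (a b : 'I_n) c : a != b ->
  (forall w, w \in G -> (w b <= c)%N /\ ((0 < w a)%N -> w b = c)) ->
  nonzerodivisor (mideal G) ('X_a - 'X_b : {mpoly K[n]}).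
Proof.
move=> neq_ab capG f /midealP Hf.
have neq_ba : b != a by rewrite eq_sym.
(* multiplication by [X_b] above the exponent [c] of [X_b], and multiplication
   by [X_a] below it, do not change membership in the ideal *)
have up_b m : (c <= m b)%N -> mon_in G (m + U_(b))%MM -> mon_in G m.
  move=> le_cm /mon_inP[g Gg /mnm_lepP le_g]; apply/mon_inP; exists g => //.
  apply/mnm_lepP => i; have := le_g i; rewrite mnmDE mnm1E.
  have [<- _|_] := eqVneq b i; last by rewrite addn0.
  by apply: leq_trans le_cm; case: (capG g Gg).
have up_a m : (m b < c)%N -> mon_in G (m + U_(a))%MM -> mon_in G m.
  move=> lt_mc /mon_inP[g Gg /mnm_lepP le_g]; apply/mon_inP; exists g => //.
  have [_ ga] := capG g Gg.
  have ga0 : g a = 0%N.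
    apply/eqP; rewrite -leqn0 leqNgt; apply/negP => /ga gb.
    by have := le_g b; rewrite mnmDE mnm1E (negPf neq_ab) addn0 gb leqNgt lt_mc.
  apply/mnm_lepP => i; have := le_g i; rewrite mnmDE mnm1E.
  by have [<- _|_] := eqVneq a i; rewrite ?ga0 ?addn0.
have shift_out m (i j : 'I_n) : m j != 0%N ->
    ~~ mon_in G (m + U_(i))%MM -> ~~ mon_in G (m + U_(i) - U_(j))%MM.
  by move=> mj; apply/contra/mon_in_le/lem_subr.
apply/midealP => m Gm; have [lt_mc|le_cm] := ltnP (m b) c.
  elim: {m}(m b) {-2}m (erefl (m b)) lt_mc Gm => [|k IH] m mb lt_mc Gm.
    have Gma : ~~ mon_in G (m + U_(a))%MM by apply: contra Gm; apply: up_a.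
    by rewrite (mcoeff_binomialM neq_ab (Hf _ Gma)) mb.
  have Gma : ~~ mon_in G (m + U_(a))%MM by apply: contra Gm; apply: up_a.
  rewrite (mcoeff_binomialM neq_ab (Hf _ Gma)) mb.
  have wb : (m + U_(a) - U_(b))%MM b = k.
    by rewrite mnmBE mnmDE !mnm1E eqxx (negPf neq_ab) addn0 mb subn1.
  by apply: IH; rewrite ?wb ?shift_out ?mb // ltnW // -mb.
have Hf' w : ~~ mon_in G w -> (('X_b - 'X_a) * f)@_w = 0.
  by move=> Gw; rewrite -opprB mulNr mcoeffN Hf ?oppr0.
elim: {m}(m a) {-2}m (erefl (m a)) le_cm Gm => [|k IH] m ma le_cm Gm.
  have Gmb : ~~ mon_in G (m + U_(b))%MM by apply: contra Gm; apply: up_b.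
  by rewrite (mcoeff_binomialM neq_ba (Hf' _ Gmb)) ma.
have Gmb : ~~ mon_in G (m + U_(b))%MM by apply: contra Gm; apply: up_b.
rewrite (mcoeff_binomialM neq_ba (Hf' _ Gmb)) ma.
have wa : (m + U_(b) - U_(a))%MM a = k.
  by rewrite mnmBE mnmDE !mnm1E eqxx (negPf neq_ba) addn0 ma subn1.
apply: IH; rewrite ?wa ?shift_out ?ma //.
by rewrite mnmBE mnmDE !mnm1E eqxx (negPf neq_ab) subn0 addn1 ltnW.
Qed.

(** * Linear relations among powers by counting standard monomials *)

(** Linear algebra on the coefficients at the monomials [dec z], the only ones
    outside the ideal that occur in some [F y]. *)
Lemma mideal_relation G (Y Z : finType) (F : Y -> {mpoly K[n]}) (dec : Z -> 'X_{1..n}) :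
  (#|Z| < #|Y|)%N ->
  (forall y m, m \in msupp (F y) -> ~~ mon_in G m -> exists z, m = dec z) ->
  exists u : Y -> K, (exists y, u y != 0) /\ mideal G (\sum_y (u y)%:MP * F y).
Proof.
move=> lt_ZY decP.
pose M : 'M[K]_(#|Y|, #|Z|) := \matrix_(i, j) (F (enum_val i))@_(dec (enum_val j)).
have : kermx M != 0.
  rewrite kermx_eq0 -row_leq_rank -ltnNge.
  exact: leq_ltn_trans (rank_leq_col M) lt_ZY.
case/rowV0Pn=> v /sub_kermxP vM v0; exists (fun y => v 0 (enum_rank y)); split.
  have [i vi] : exists i, v 0 i != 0.
    apply/existsP; apply: contraR v0 => /existsPn H.
    by apply/eqP/rowP => i; rewrite mxE; apply/eqP/negPn/H.
  by exists (enum_val i); rewrite enum_valK.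
apply/midealP => m Gm; rewrite raddf_sum /=.
have [/existsP[y Fy]|/existsPn noF] := boolP [exists y, m \in msupp (F y)].
  have [z def_m] := decP y m Fy Gm.
  transitivity ((v *m M) 0 (enum_rank z)); last by rewrite vM mxE.
  rewrite mxE (reindex _ (onW_bij _ (enum_val_bij Y))) /=.
  apply: eq_bigr => i _; rewrite mcoeffCM enum_valK mxE enum_rankK -def_m.
  by [].
by rewrite big1 // => y _; rewrite mcoeffCM memN_msupp_eq0 ?mulr0.
Qed.

Definition mdeg_le D f := all (fun m => (mdeg m <= D)%N) (msupp f).

Lemma mdeg_leM D1 D2 f g : mdeg_le D1 f -> mdeg_le D2 g -> mdeg_le (D1 + D2) (f * g).
Proof.
move=> /allP Hf /allP Hg;
  apply/allP => m /msuppM_le/allpairsP[[m1 m2] /= [/Hf H1 /Hg H2 ->]].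
by rewrite mdegD leq_add.
Qed.

Lemma mdeg_leX D f k : mdeg_le D f -> mdeg_le (D * k) (f ^+ k).
Proof.
move=> Hf; elim: k => [|k IH]; last by rewrite exprS mulnS mdeg_leM.
by rewrite muln0 /mdeg_le expr0 msupp1 /= mdeg0.
Qed.

Lemma mdeg_le_eval_expo D N k (x : nat -> {mpoly K[n]}) (a : expo N k) :
  (forall i, (i < k)%N -> mdeg_le D (x i)) -> mdeg_le (D * N * k) (eval_expo x a).
Proof.
elim: k x a => [|k IH] x a Hx; first by rewrite muln0 /mdeg_le msupp1 /= mdeg0.
rewrite /= mulnS; apply: mdeg_leM; last by apply: IH => i lt_ik; apply: Hx.
have /allP H := mdeg_leX a.1 (Hx 0%N isT); apply/allP => m /H.
by move=> le_m; apply: leq_trans le_m _; rewrite leq_mul // ltnW.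
Qed.

(** A bound on the Hilbert function of the quotient by [mideal G]. Counting the
    monomials outside the ideal by a surjection [dec] avoids describing them
    exactly. *)
Definition growth_le G q := exists C, forall E,
  exists (Z : finType) (dec : Z -> 'X_{1..n}), (#|Z| <= C * E ^ q)%N /\
    forall w, ~~ mon_in G w -> (forall i, (w i < E)%N) -> exists z, w = dec z.

(** The number of products of [q + 1] elements with exponents below [N] grows like
    [N ^ q.+1], while the number of monomials outside the ideal that occur in
    these products grows like [N ^ q] only. *)
Lemma growth_relation G q (x : nat -> {mpoly K[n]}) : growth_le G q ->
  exists N (u : expo N q.+1 -> K),
    (exists a, u a != 0) /\ mideal G (\sum_a (u a)%:MP * eval_expo x a).
Proof.
case=> C growth.
have [D HD] : exists D, forall i, (i < q.+1)%N -> mdeg_le D (x i).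
  exists (\max_(i < q.+1) msize (x i)) => i lt_iq; apply/allP => w /msize_mdeg_lt/ltnW.
  by move/leq_trans; apply; apply: (leq_bigmax (Ordinal lt_iq)).
(* [B * N] bounds the exponents in the products, and [C * (B * N) ^ q] is less
   than [N ^ q.+1] *)
pose B := (D * q.+1).+1; pose N := (C * B ^ q).+1.
have [Z [dec [leZ decP]]] := growth (B * N)%N.
exists N; apply: (mideal_relation (dec := dec)) => [|y w Hw Gw].
  rewrite card_expo; apply: leq_ltn_trans leZ _.
  by rewrite expnMn mulnA expnS ltn_pmul2r ?expn_gt0 // ltnSn.
apply: decP => // i; have /allP/(_ _ Hw) := mdeg_le_eval_expo y HD.
rewrite mdegE (bigD1 i) //= => H; apply: leq_ltn_trans (leq_trans (leq_addr _ _) H) _.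
by rewrite /B mulSn mulnAC -addn1 addnC leq_add2r // mulnC.
Qed.

Lemma growth_no_chain G q (B : nat -> {mpoly K[n]} -> Prop) (x : nat -> {mpoly K[n]}) :
  growth_le G q ->
  (forall i, (i <= q.+1)%N -> is_ideal (B i)) ->
  (forall i f, (i < q.+1)%N -> B i f -> B i.+1 f) ->
  (forall i, (i < q.+1)%N -> B i.+1 (x i)) ->
  (forall i, (i < q.+1)%N -> nonzerodivisor (B i) (x i)) ->
  (forall f, mideal G f -> B 0%N f) -> B q.+1 1.
Proof.
move=> /(growth_relation x)[N [u [[a ua] rel]]] idB subB Bx nzd GB.
apply: (collapse (u := fun a => (u a)%:MP) idB subB Bx nzd).
- move=> b; rewrite mpolyC_eq0 => ub; exists ((u b)^-1)%:MP.
  by rewrite -mpolyCM mulVf.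
- by exists a; rewrite mpolyC_eq0.
exact: GB.
Qed.

Lemma regular_seq_size G q s : growth_le G q -> regular_seq (mideal G) s -> (size s
  <= q)%N.
Proof.
move=> growth [reg not1]; rewrite leqNgt; apply/negP => lt_qs; apply: not1.
pose B i := add_gens (mideal G) (take i s).
have idB i : is_ideal (B i) by apply: add_gens_ideal.
have subB i j f : (i <= j)%N -> B i f -> B j f.
  move=> le_ij; apply: ideal_gen_min => // g [Ig|]; last rewrite -(take_takel s le_ij).
    by apply: ideal_gen_incl; left.
  by move/mem_take=> sg; apply: ideal_gen_incl; right.
apply: (subB q.+1) => //.
apply: (growth_no_chain (x := nth 0 s) growth) => // [i f lt_iq|i lt_iq|i lt_iq f|f Gf].
- exact: subB.
- apply: ideal_gen_incl; right; rewrite -(nth_take 0 (ltnSn i)) mem_nth //.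
  by rewrite size_takel // (leq_trans lt_iq lt_qs).
- by move=> Hf; exact: (reg i f (leq_trans lt_iq lt_qs) Hf).
by apply: ideal_gen_incl; left.
Qed.

Lemma finite_choice (T : Type) (x0 : T) k (R : nat -> T -> Prop) :
  (forall i, (i < k)%N -> exists x, R i x) ->
  exists x : nat -> T, forall i, (i < k)%N -> R i (x i).
Proof.
elim: k => [|k IH] H; first by exists (fun=> x0).
have [i lt_ik|x Hx] := IH; first by apply/H/ltnW.
have [y Hy] := H k (ltnSn k).
exists (fun i => if i == k then y else x i) => i; rewrite ltnS leq_eqVlt.
by have [->|_] := eqVneq i k => //= /Hx.
Qed.

Lemma prime_chain_size G q k P :
  growth_le G q -> prime_chain (mideal G) k P -> (k <= q)%N.
Proof.
move=> growth [primeP subP]; rewrite leqNgt; apply/negP => lt_qk.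
have idP i : (i <= k)%N -> is_ideal (fun f => f \in P i).
  move=> /primeP[[P0 _ PD] _ _]; split=> // [f g Pf Pg|a f Pf].
    by rewrite -(mul1r f); apply: PD.
  by rewrite -(addr0 (a * f)); apply: PD.
have [x Hx] : exists x : nat -> {mpoly K[n]}, forall i, (i < k)%N ->
    x i \in P i.+1 /\ x i \notin P i.
  apply: (finite_choice 0 (R := fun i f => f \in P i.+1 /\ f \notin P i)) => i.
  by case/subP=> _ [f Pf nPf]; exists f.
have [[_ not1 _] _ _] := primeP q.+1 lt_qk; case/negP: not1.
apply: (growth_no_chain (B := fun i f => f \in P i) (x := x) growth)
  => [i le_iq|i f lt_iq|i lt_iq|i lt_iq f|f Gf].
- exact/idP/(leq_trans le_iq).
- by case: (subP i (leq_trans lt_iq lt_qk)) => H _; apply: H.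
- by case: (Hx i (leq_trans lt_iq lt_qk)).
- have lt_ik := leq_trans lt_iq lt_qk; have [_ /negPf nPx] := Hx i lt_ik.
  have [_ primePi _] := primeP i (ltnW lt_ik).
  by move/primePi; rewrite nPx.
by case: (primeP 0%N isT) => _ _; apply.
Qed.

End MonomialIdeals.

(** * Substitutions of variables *)

Section Substitution.
Local Open Scope ring_scope.
Variables (K : fieldType) (n : nat).
Implicit Types (G : seq 'X_{1..n}) (m w : 'X_{1..n}) (f g : {mpoly K[n]}).
Implicit Types (J : {mpoly K[n]} -> Prop) (s : seq {mpoly K[n]}).

Section Def.
Variable th : 'I_n -> {mpoly K[n]}.

Definition subst f : {mpoly K[n]} := mmap (@mpolyC n K) th f.

Lemma subst0 : subst 0 = 0. Proof. exact: rmorph0. Qed.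
Lemma subst1 : subst 1 = 1. Proof. exact: rmorph1. Qed.
Lemma substD f g : subst (f + g) = subst f + subst g. Proof. exact: rmorphD. Qed.
Lemma substB f g : subst (f - g) = subst f - subst g. Proof. exact: rmorphB. Qed.
Lemma substM f g : subst (f * g) = subst f * subst g. Proof. exact: rmorphM. Qed.
Lemma substXU i : subst 'X_i = th i. Proof. by rewrite /subst mmapX mmap1U. Qed.

Lemma substX m : subst 'X_[m] = \prod_(i < n) th i ^+ m i.
Proof. by rewrite /subst mmapX. Qed.

Lemma substC c : subst c%:MP = c%:MP. Proof. exact: mmapC. Qed.

Lemma subst_preim_ideal J : is_ideal J -> is_ideal (fun f => J (subst f)).
Proof.
case=> J0 JD JM; split=> [|f g Hf Hg|a f Hf]; first by rewrite subst0.
  by rewrite substD; apply: JD.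
by rewrite substM; apply: JM.
Qed.

(** Congruence modulo [J] is compatible with sums and products, so only the
    variables have to be checked. *)
Lemma subst_congr J f : is_ideal J ->
  (forall i, J ('X_i - th i)) -> J (f - subst f).
Proof.
move=> JI Hth; have [_ JD JM] := JI.
have congM a b c e : J (a - b) -> J (c - e) -> J (a * c - b * e).
  move=> Hab Hce; have -> : a * c - b * e = c * (a - b) + b * (c - e).
    by rewrite !mulrBr addrA [c * b]mulrC subrK mulrC.
  by apply: JD; apply: JM.
have -> : f - subst f = \sum_(m <- msupp f) (f@_m *: 'X_[m] - subst (f@_m *: 'X_[m])).
  by rewrite sumrB -mpolyE; congr (_ - _); rewrite [in LHS](mpolyE f) /subst rmorph_sum.
apply: is_ideal_sum => // m _; rewrite -mul_mpolyC substM substC -mulrBr; apply: JM.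
rewrite substX [X in X - _]mpolyXE_id.
apply: (big_ind2 (fun a b => J (a - b))) => [|a b c e|i _].
- by rewrite subrr; case: JI.
- exact: congM.
elim: (m i) => [|k IH]; first by rewrite !expr0 subrr; case: JI.
by rewrite !exprS; apply: congM.
Qed.

Lemma add_gens_zero_subst s f :
  (forall y, y \in s -> subst y = 0) ->
  (forall i, add_gens (@zero_ideal _) s ('X_i - th i)) ->
  add_gens (@zero_ideal _) s f <-> subst f = 0.
Proof.
move=> s0 Hth; split.
  apply: (ideal_gen_min (I := fun f => subst f = 0)).
    by apply: (subst_preim_ideal (J := @zero_ideal _)); apply: zero_ideal_ideal.
  by move=> g [->|/s0 //]; rewrite subst0.
move=> f0; have := subst_congr f (add_gens_ideal _ _) Hth.
by rewrite f0 subr0.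
Qed.

(** The ideal generated by [s] is the kernel of the substitution, hence prime. *)
Lemma add_gens_zero_nzd s y :
  (forall y, y \in s -> subst y = 0) ->
  (forall i, add_gens (@zero_ideal _) s ('X_i - th i)) ->
  subst y != 0 -> nonzerodivisor (add_gens (@zero_ideal _) s) y.
Proof.
move=> s0 Hth y0 f; rewrite !add_gens_zero_subst // substM => /eqP.
by rewrite mulf_eq0 (negPf y0) => /eqP.
Qed.

End Def.

(** The monomial that results from [m] when [X_i] is renamed to [X_(tau i)]. *)
Definition merge (tau : 'I_n -> 'I_n) m : 'X_{1..n} :=
  (\sum_(i < n) U_(tau i) *+ m i)%MM.

Lemma mergeE tau m j : merge tau m j = (\sum_(i < n | tau i == j) m i)%N.
Proof.
rewrite /merge mnm_sumE [RHS]big_mkcond; apply: eq_bigr => i _.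
by rewrite mulmnE mnm1E; case: eqP; rewrite ?mul1n.
Qed.

Lemma subst_merge tau m : subst (fun i => 'X_(tau i)) 'X_[m] = 'X_[merge tau m].
Proof.
by rewrite substX /merge mprodXnE.
Qed.

(** Adding to a monomial ideal the differences [X_i - X_(tau i)] amounts to
    renaming the variables, after which the ideal is again monomial. *)
Lemma mideal_add_gens G tau s f :
  (forall y, y \in s -> subst (fun i => 'X_(tau i)) y = 0) ->
  (forall i, add_gens (fun f => mideal G f) s ('X_i - 'X_(tau i))) ->
  add_gens (fun f => mideal G f) s f <->
  mideal (map (merge tau) G) (subst (fun i => 'X_(tau i)) f).
Proof.
move=> s0 Hth; split.
  have preI := subst_preim_ideal (fun i => 'X_(tau i)) (mideal_is_ideal K (map (merge
    tau) G)).
  apply: (ideal_gen_min preI) => g [|/s0->];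
    last by case: (mideal_is_ideal K (map (merge tau) G)).
  apply: (mideal_min preI) => w Gw.
  by rewrite subst_merge mideal_mpolyX; apply/mon_inP; exists (merge tau w);
    rewrite ?map_f ?lepm_refl.
have sumI := add_gens_ideal (fun f => mideal G f) s.
move=> Gf; apply/(is_ideal_congr sumI (subst_congr f sumI Hth)).
apply: (mideal_min sumI) Gf => _ /mapP[w Gw ->]; rewrite -subst_merge.
apply/(is_ideal_congr sumI (subst_congr 'X_[w] sumI Hth)).
apply: ideal_gen_incl; left; rewrite mideal_mpolyX; apply/mon_inP.
by exists w; rewrite ?lepm_refl.
Qed.

Lemma mideal_add_gens_nzd G tau s (a b : 'I_n) c :
  (forall y, y \in s -> subst (fun i => 'X_(tau i)) y = 0) ->
  (forall i, add_gens (fun f => mideal G f) s ('X_i - 'X_(tau i))) ->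
  tau a = a -> tau b = b -> a != b ->
  (forall w, w \in G -> (merge tau w b <= c)%N /\ ((0 < merge tau w a)%N -> merge tau
    w b = c)) ->
  nonzerodivisor (add_gens (fun f => mideal G f) s) ('X_a - 'X_b).
Proof.
move=> s0 Hth tau_a tau_b neq_ab capG f.
rewrite !(mideal_add_gens _ s0 Hth) substM substB !substXU tau_a tau_b.
by apply: (mideal_nzd neq_ab) => _ /mapP[w Gw ->]; apply: capG.
Qed.

End Substitution.

(** * Monomial ideals whose generators fill columns of variables *)

Section Columns.
Local Open Scope ring_scope.
Variables (K : fieldType) (d r : nat).
Local Notation T := ('I_d * 'I_r.+1)%type.
Local Notation S := {mpoly K[#|{: T}|]}.
Local Notation X := (@vvar T K).
Implicit Types (u v : T) (P : seq T) (Q : seq 'I_d).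

Definition base v : T := (v.1, ord0).

Lemma X_neq0 v : X v != 0.
Proof. by rewrite -msupp_eq0 msuppX. Qed.

Lemma X_inj : injective X.
Proof.
move=> u v /(congr1 (mcoeff U_(enum_rank u))); rewrite !mcoeffX eqxx eq_mnm1.
case: eqP => [/enum_rank_inj-> //|_ /eqP]; by rewrite oner_eq0.
Qed.

Definition mnm_of (h : T -> nat) : 'X_{1..#|{: T}|} := [multinom h (enum_val i) | i <
  #|{: T}|].

Lemma mnm_ofE h v : mnm_of h (enum_rank v) = h v.
Proof. by rewrite mnmE enum_rankK. Qed.

Lemma mnm_eqT (m w : 'X_{1..#|{: T}|}) :
  (forall v, m (enum_rank v) = w (enum_rank v)) -> m = w.
Proof. by move=> H; apply/mnmP => i; rewrite -(enum_valK i). Qed.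

Lemma mnm_leT (m w : 'X_{1..#|{: T}|}) :
  (forall v, (m (enum_rank v) <= w (enum_rank v))%N) <-> (m <= w)%MM.
Proof.
split=> [H|/mnm_lepP H v //]; apply/mnm_lepP => i.
by rewrite -(enum_valK i).
Qed.

Definition substT (th : T -> S) : S -> S := subst (fun i => th (enum_val i)).

Lemma substTX th v : substT th (X v) = th v.
Proof. by rewrite /substT /vvar substXU enum_rankK. Qed.

Definition col_diffs P : seq S := [seq X v - X (base v) | v <- P].
Definition base_vars Q : seq S := [seq X (i, ord0) | i <- Q].

Definition upper v := v.2 != ord0.

Lemma base_upper P v : all upper P -> base v \notin P.
Proof. by move/allP => upP; apply/negP => /upP; rewrite /upper eqxx. Qed.

(** ** Regularity on the polynomial ring *)

Section PolynomialRing.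

(** The substitution whose kernel is generated by [X_v - X_(base v)] for [v] in [P]
    and by [X_(i,0)] for [i] in [Q]. *)
Definition kill_merge P Q v : S :=
  if (v.2 == ord0) || (v \in P) then (if v.1 \in Q then 0 else X (base v)) else X v.

Let gens P Q := col_diffs P ++ base_vars Q.

Lemma kill_merge_gens P Q y : all upper P ->
  y \in gens P Q -> substT (kill_merge P Q) y = 0.
Proof.
move=> upP; rewrite mem_cat => /orP[]/mapP[v Pv ->].
  by rewrite /substT substB -!/(substT _ _) !substTX /kill_merge /= Pv orbT /= subrr.
by rewrite substTX /kill_merge /= Pv.
Qed.

Lemma kill_merge_congr P Q (i : 'I_#|{: T}|) :
  add_gens (@zero_ideal _) (gens P Q) ('X_i - kill_merge P Q (enum_val i)).
Proof.
have [A0 AD AM] := add_gens_ideal (@zero_ideal S) (gens P Q).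
rewrite -{1}(enum_valK i) -/(vvar _ _); move: (enum_val i) => {i} v.
have gen y : y \in gens P Q -> add_gens (@zero_ideal _) (gens P Q) y.
  by move=> Gy; apply: ideal_gen_incl; right.
have base_gen : v.1 \in Q -> add_gens (@zero_ideal _) (gens P Q) (X (base v)).
  by move=> Qv; apply: gen; rewrite mem_cat; apply/orP; right; apply/mapP; exists v.1.
rewrite /kill_merge; case: ifP => [|_]; last by rewrite subrr.
have diff_gen : (v.2 == ord0) || (v \in P) ->
    add_gens (@zero_ideal _) (gens P Q) (X v - X (base v)).
  case: eqP => [v0 _|_ /= Pv]; last first.
    by apply: gen; rewrite mem_cat; apply/orP; left; apply/mapP; exists v.
  by rewrite /base -v0 -surjective_pairing subrr.
move/diff_gen => Dv; case: ifP => [/base_gen Bv|//].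
by rewrite subr0 -(subrK (X (base v)) (X v)); apply: AD.
Qed.

Lemma weakly_regular_ring P Q : uniq P -> all upper P -> uniq Q ->
  weakly_regular (@zero_ideal S) (gens P Q).
Proof.
move=> uniqP upP; elim/last_ind: Q => [_|Q i IH].
  rewrite /gens cats0; elim/last_ind: P uniqP upP => [//|P a IH].
  rewrite rcons_uniq all_rcons => /andP[nPa uniqP] /andP[upa upP].
  rewrite /col_diffs map_rcons; apply/weakly_regular_rcons; split; first exact: IH.
  have := add_gens_zero_nzd (s := gens P [::]) (th := fun i => kill_merge P [::]
    (enum_val i)).
  rewrite {1 3}/gens cats0; apply; last 1 first.
  - rewrite substB -!/(substT _ _) !substTX /kill_merge /= (negPf nPa) (negPf upa) /=.
    by rewrite subr_eq0 (inj_eq X_inj); apply: contra upa => /eqP->.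
  - by move=> y Py; apply: kill_merge_gens => //; rewrite /gens cats0.
  by move=> j; have := kill_merge_congr P [::] j; rewrite /gens cats0.
rewrite rcons_uniq => /andP[nQi uniqQ].
rewrite /gens /base_vars map_rcons -rcons_cat; apply/weakly_regular_rcons.
split; first exact: IH.
apply: (add_gens_zero_nzd (th := fun i => kill_merge P Q (enum_val i))).
- by move=> y; apply: kill_merge_gens.
- exact: kill_merge_congr.
by rewrite -/(substT _ _) substTX /kill_merge /= (negPf nQi) X_neq0.
Qed.

End PolynomialRing.

(** ** The ideal generated by column-filling monomials *)

Section Generators.
Variables (G : seq 'X_{1..#|{: T}|}) (cap : T -> nat).
Local Notation "w .{ v }" := ((w : 'X_{1..#|{: T}|}) (enum_rank v)) (at level 2).
Hypothesis G_fill : forall w, w \in G -> forall i j,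
  (w.{(i, j)} <= cap (i, j))%N /\
  ((0 < w.{(i, j)})%N -> forall j' : 'I_r.+1, (j' < j)%N -> w.{(i, j')} = cap (i, j')).

Local Notation I := (fun f : S => mideal G f).

Definition to_base P v : T := if v \in P then base v else v.
Definition tau P (i : 'I_#|{: T}|) : 'I_#|{: T}| := enum_rank (to_base P (enum_val i)).

Lemma tau_rank P v : tau P (enum_rank v) = enum_rank (to_base P v).
Proof. by rewrite /tau enum_rankK. Qed.

Lemma subst_tau_X P v : subst (fun i => 'X_(tau P i)) (X v) = X (to_base P v).
Proof. by rewrite /vvar substXU tau_rank. Qed.

Lemma to_base_base P v : all upper P -> to_base P (base v) = base v.
Proof. by move=> upP; rewrite /to_base (negPf (base_upper _ upP)). Qed.

Lemma tau_gens P y : all upper P -> y \in col_diffs P -> subst (fun i => 'X_(tau P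
  i)) y = 0.
Proof.
move=> upP /mapP[v Pv ->]; rewrite substB !subst_tau_X to_base_base //.
by rewrite /to_base Pv subrr.
Qed.

Lemma tau_congr P i : add_gens I (col_diffs P) ('X_i - 'X_(tau P i)).
Proof.
rewrite -{1}(enum_valK i) -/(vvar _ _) /tau -/(vvar _ _) /to_base.
case: ifP => [Pv|_]; last by rewrite subrr; case: (add_gens_ideal I (col_diffs P)).
by apply: ideal_gen_incl; right; apply: map_f.
Qed.

Lemma merge_tauE P w v :
  (merge (tau P) w).{v} = (\sum_(u | to_base P u == v) w.{u})%N.
Proof.
rewrite mergeE (reindex _ (onW_bij _ (enum_rank_bij T))) /=.
by apply: eq_bigl => u; rewrite tau_rank (inj_eq enum_rank_inj).
Qed.

(** The variables of a column are merged from the bottom up. A generator that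
    involves the next variable [X_a] is filled below it, so that its exponent in
    the variable into which these were merged is the maximum [c]. *)
Lemma weakly_regular_columns P : all upper P ->
  pairwise (fun u v => (u.1 == v.1) ==> (u.2 < v.2)%N) P ->
  weakly_regular I (col_diffs P).
Proof.
elim/last_ind: P => [//|P a IH].
rewrite all_rcons pairwise_rcons => /andP[upa upP] /andP[/allP ltPa pwP].
rewrite /col_diffs map_rcons; apply/weakly_regular_rcons; split; first exact: IH.
have nPa : a \notin P by apply/negP => /ltPa; rewrite eqxx ltnn.
have eq_a u : (to_base P u == a) = (u == a).
  rewrite /to_base; case: ifP => [Pu|//]; apply/eqP/eqP => [eq_ua|eq_ua].
    by move: upa; rewrite -eq_ua /upper eqxx.
  by rewrite -eq_ua Pu in nPa.
pose c := (\sum_(u | to_base P u == base a) cap u)%N.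
apply: (mideal_add_gens_nzd (tau := tau P) (c := c)).
- by move=> y; apply: tau_gens.
- exact: tau_congr.
- by rewrite tau_rank /to_base (negPf nPa).
- by rewrite tau_rank to_base_base.
- by rewrite (inj_eq enum_rank_inj); apply: contra upa => /eqP->.
move=> w Gw; rewrite !merge_tauE; split.
  by apply: leq_sum => -[i j] _; case: (G_fill Gw i j).
rewrite (eq_bigl _ _ eq_a) big_pred1_eq;
  case: a upa ltPa {nPa eq_a} @c => i j upa ltPa c wa.
have [_ /(_ wa) fill] := G_fill Gw i j.
apply: eq_bigr => -[i' j'] /eqP; rewrite /to_base; case: ifP => [Pu|_] [eq_i].
  by rewrite eq_i fill //; move: (ltPa _ Pu); rewrite /= eq_i eqxx.
by move=> ->; rewrite eq_i fill // lt0n.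
Qed.

Hypothesis G_column : forall i, exists2 w, w \in G & forall v, v.1 != i -> w.{v} = 0%N.
Hypothesis G_base : forall w, w \in G -> exists i, (0 < w.{(i, ord0)})%N.

(** Sorted by level, so that each column is merged from the bottom up. *)
Definition uppers : seq T := sort (fun u v => (u.2 <= v.2)%N) (enum [pred v | upper v]).

Lemma mem_uppers v : (v \in uppers) = upper v.
Proof. by rewrite mem_sort mem_enum. Qed.

Lemma uniq_uppers : uniq uppers.
Proof. by rewrite sort_uniq enum_uniq. Qed.

Lemma all_uppers : all upper uppers.
Proof. by apply/allP => v; rewrite mem_uppers. Qed.

Lemma size_uppers : size uppers = (d * r)%N.
Proof.
rewrite size_sort -cardE -(eq_card (A := predX predT (predC1 ord0))) => [|v].
  by rewrite cardX cardC1 !card_ord.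
by rewrite !inE.
Qed.

Lemma pairwise_uppers : pairwise (fun u v => (u.1 == v.1) ==> (u.2 < v.2)%N) uppers.
Proof.
have : pairwise (fun u v => (u.2 <= v.2)%N && (u != v)) uppers.
  rewrite pairwise_relI -uniq_pairwise uniq_uppers andbT -sorted_pairwise.
    by apply: sort_sorted => u v; apply: leq_total.
  by move=> u v w; apply: leq_trans.
apply: sub_pairwise => -[i j] [i' j'] /= /andP[le_j neq]; apply/implyP => /eqP eq_i.
rewrite ltn_neqAle le_j andbT; apply: contra neq => /eqP eq_j.
by rewrite eq_i; apply/eqP; congr pair; apply: val_inj.
Qed.

Lemma to_base_uppers v : to_base uppers v = base v.
Proof.
rewrite /to_base mem_uppers /upper; case: eqP => //= v0.
by rewrite /base -v0 -surjective_pairing.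
Qed.

(** The exponent of [X_i] in [w] once all the variables of each column have been
    identified. *)
Definition colsum (w : 'X_{1..#|{: T}|}) i := (\sum_(j < r.+1) w.{(i, j)})%N.

Lemma merge_uppers w v :
  (merge (tau uppers) w).{v} = if v.2 == ord0 then colsum w v.1 else 0%N.
Proof.
rewrite merge_tauE; case: v => i j /=; case: eqP => [->|j0]; last first.
  by rewrite big1 // => u; rewrite to_base_uppers => /eqP[_ eq_j]; rewrite eq_j in j0.
rewrite (eq_bigl (fun u : T => (u.1 == i) && true)) => [|[i' j']]; last first.
  by rewrite to_base_uppers xpair_eqE eqxx.
transitivity (\sum_(i' | i' == i) \sum_(j < r.+1) w.{(i', j)})%N.
  by rewrite pair_big; apply: eq_bigr; case.
by rewrite big_pred1_eq.
Qed.

(** The monomial with exponents [a] spans a line of the socle of the Artinian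
    quotient: it is nonzero there and killed by every variable. *)
Definition corner (a : {ffun 'I_d -> nat}) : Prop :=
  (forall w, w \in G -> exists i, (a i < colsum w i)%N) /\
  (forall i, exists2 w, w \in G & forall i', (colsum w i' <= a i' + (i' == i))%N).

Definition corner_mnm (a : {ffun 'I_d -> nat}) : 'X_{1..#|{: T}|} :=
  mnm_of (fun v => if v.2 == ord0 then a v.1 else 0%N).

Local Notation G' := (map (merge (tau uppers)) G).
Local Notation phi := (subst (fun i => 'X_(tau uppers i) : S)).
Local Notation B := (add_gens I (col_diffs uppers)).

Lemma quotientE f : B f <-> mideal G' (phi f).
Proof.
apply: mideal_add_gens; first by move=> y; apply: tau_gens all_uppers.
exact: tau_congr.
Qed.

(** The case [None] tests a monomial, and the case [Some i] tests its multiple by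
    the variable of column [i]. *)
Lemma mon_in_merged a (i : option 'I_d) :
  mon_in G' (corner_mnm a + (if i is Some i then U_(enum_rank (i, ord0)) else 0))%MM <->
  exists2 w, w \in G & forall i', (colsum w i' <= a i' + (Some i' == i))%N.
Proof.
have rhsE v : (corner_mnm a + (if i is Some i then U_(enum_rank (i, ord0)) else
  0))%MM.{v} =
    if v.2 == ord0 then (a v.1 + (Some v.1 == i))%N else 0%N.
  rewrite mnmDE mnm_ofE; case: v i => [i' j] [i|] /=; last first.
    by rewrite mnm0E addn0; case: ifP; rewrite ?addn0.
  rewrite mnm1E (inj_eq enum_rank_inj) xpair_eqE (eq_sym i) (eq_sym ord0).
  rewrite (_ : (Some i' == Some i) = (i' == i)) //.
  by case: (j == ord0); rewrite ?andbT ?andbF ?addn0.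
split=> [/mon_inP[_ /mapP[w Gw ->] /mnm_leT le_w]|[w Gw le_w]].
  by exists w => // i'; have := le_w (i', ord0); rewrite merge_uppers rhsE eqxx.
apply/mon_inP; exists (merge (tau uppers) w); rewrite ?map_f //.
apply/mnm_leT => v; rewrite merge_uppers rhsE; by case: ifP.
Qed.

Lemma corner_out a : corner a -> ~~ mon_in G' (corner_mnm a).
Proof.
case=> out _; apply/negP; rewrite -(addm0 (corner_mnm a)).
case/(mon_in_merged a None) => w Gw le_w; have [i lt_i] := out w Gw.
by have := le_w i; rewrite addn0 leqNgt lt_i.
Qed.

Lemma corner_mnm_inj : injective corner_mnm.
Proof.
move=> a b /mnmP eq_ab; apply/ffunP => i.
by have := eq_ab (enum_rank (i, ord0)); rewrite !mnm_ofE eqxx.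
Qed.

(** After the identification of columns only the variables [X_(i,0)] occur. *)
Lemma msupp_phi f m : m \in msupp (phi f) -> exists a, m = corner_mnm a.
Proof.
move=> Hm; exists [ffun i => m (enum_rank (i, ord0))]; apply: mnm_eqT => v.
rewrite mnm_ofE ffunE; case: eqP => [v0|v0].
  by rewrite -v0 -surjective_pairing.
have : m \in flatten [seq msupp (phi (f@_w *: 'X_[w])) | w <- msupp f].
  move: Hm; rewrite {1}(mpolyE f) /subst rmorph_sum => /msupp_sum_le.
  by rewrite filter_predT.
case/flatten_mapP => w _; rewrite -mul_mpolyC substM substC subst_merge mul_mpolyC.
move=> /msuppZ_le; rewrite msuppX inE => /eqP->.
by rewrite merge_uppers; case: eqP.
Qed.

Lemma phi_corner a : phi 'X_[corner_mnm a] = 'X_[corner_mnm a].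
Proof.
rewrite subst_merge; congr 'X_[_]; apply: mnm_eqT => v.
rewrite merge_uppers mnm_ofE; case: eqP => // _.
rewrite /colsum (bigD1 ord0) //= big1 => [|j j0]; rewrite mnm_ofE /=.
  by rewrite addn0.
by rewrite (negPf j0).
Qed.

Lemma phi_base i : phi (X (i, ord0)) = X (i, ord0).
Proof. by rewrite subst_tau_X to_base_uppers. Qed.

(** ** Dimension, depth and type *)

Lemma quotient_proper : ~ B 1.
Proof.
move/quotientE; rewrite subst1 /mideal msupp1 /= andbT.
case/mon_inP=> _ /mapP[w /G_base[i wi] ->] /mnm_leT/(_ (i, ord0)).
rewrite merge_uppers eqxx mnm0E leqn0 /colsum => /eqP sum0.
by rewrite (bigD1 ord0) //= in sum0; move: wi sum0; case: w.{_}.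
Qed.

Lemma regular_seq_columns : regular_seq I (col_diffs uppers).
Proof.
split; last by rewrite take_size; apply: quotient_proper.
by apply: weakly_regular_columns; [exact: all_uppers | exact: pairwise_uppers].
Qed.

(** A monomial outside the ideal is not divisible by the generator supported on
    any given column, so one of its exponents in each column is bounded by a
    constant, and only [r] exponents per column are free. *)
Lemma growth_columns : growth_le G (d * r).
Proof.
pose N0 := (\max_(w <- G) \max_(v : T) w.{v}).+1.
exists ((r.+1 * N0) ^ d)%N => E.
pose Z := {ffun 'I_d -> 'I_r.+1 * 'I_N0 * {ffun 'I_r -> 'I_E}}.
pose dec (z : Z) := mnm_of (fun v =>
  let: (j0, c, g) := z v.1 in if unlift j0 v.2 is Some k then g k : nat else c).
exists Z, dec; split.
  by rewrite card_ffun !card_prod card_ffun !card_ord expnMn -expnM [(r * d)%N]mulnC.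
move=> m Gm lt_mE.
have low i : {j | (m.{(i, j)} < N0)%N}.
  apply: sigW; have [w Gw wi] := G_column i.
  have /existsP[[i' j] lt_mw] : [exists v : T, (m.{v} < w.{v})%N].
    apply: contraR Gm => /existsPn H; apply/mon_inP; exists w => //.
    by apply/mnm_leT => v; rewrite leqNgt; apply: H.
  have [eq_i|neq_i] := eqVneq i' i; last by rewrite (wi (i', j)) in lt_mw.
  exists j; rewrite -eq_i; apply: leq_trans lt_mw _; rewrite ltnW // ltnS.
  apply: leq_trans (leq_bigmax_seq _ Gw _) => //.
  exact: (leq_bigmax (i', j)).
exists [ffun i => (sval (low i), Ordinal (svalP (low i)),
  [ffun k => Ordinal (lt_mE (enum_rank (i, lift (sval (low i)) k)))])].
apply: mnm_eqT => -[i j]; rewrite mnm_ofE ffunE /=.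
by case: unliftP => [k ->|->] /=; rewrite ?ffunE.
Qed.

Lemma depth_columns : depth (@vars_ideal K #|{: T}|) I (d * r)%N.
Proof.
split; last by move=> s _; apply: regular_seq_size growth_columns.
exists (col_diffs uppers); split; last by rewrite size_map size_uppers.
  move=> _ /mapP[v _ ->]; have VI := ideal_gen_ideal (fun f : S => exists i, f = 'X_i).
  by apply: is_idealB VI _ _; apply: ideal_gen_incl; eexists.
exact: regular_seq_columns.
Qed.

(** The kernels of these substitutions are prime ideals generated by variables;
    as [P] grows through [uppers], they form a chain of maximal length. *)
Definition kill P v : S := if (v.2 == ord0) || (v \in P) then 0 else X v.

Lemma krull_dim_columns : krull_dim I (d * r)%N.
Proof.
split; last by move=> k P; apply: prime_chain_size growth_columns.
pose ker P : {pred S} := fun f => substT (kill P) f == 0.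
exists (fun t => ker (take t uppers)); split.
  move=> t _; split.
  - split; rewrite ?unfold_in /substT ?subst0 ?subst1 ?oner_eq0 //.
    move=> a f g; rewrite !unfold_in /substT substD substM => /eqP-> /eqP->.
    by rewrite mulr0 addr0.
  - by move=> f g; rewrite !unfold_in /substT substM mulf_eq0.
  have kerI := subst_preim_ideal (fun i => kill (take t uppers) (enum_val i))
    (zero_ideal_ideal S).
  move=> f /(mideal_min kerI) H; rewrite unfold_in; apply/eqP/H => w /G_base[i wi].
  rewrite /zero_ideal substX (bigD1 (enum_rank (i, ord0))) //= enum_rankK.
  by rewrite /kill /= expr0n (gtn_eqF wi) mul0r.
move=> t lt_t; have lt_tL : (t < size uppers)%N by rewrite size_uppers.
have [a0 _] : exists a0 : T, true by case: (uppers) lt_tL => // a; exists a.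
have def_take : take t.+1 uppers = rcons (take t uppers) (nth a0 uppers t).
  exact: take_nth.
split.
  move=> f; rewrite !unfold_in => /eqP f0.
  have kerI := subst_preim_ideal (fun i => kill (take t.+1 uppers) (enum_val i))
    (zero_ideal_ideal S).
  have := subst_congr (th := fun i => kill (take t uppers) (enum_val i)) f kerI.
  rewrite -/(substT (kill (take t uppers)) f) f0 subr0 => kerP; apply/eqP/kerP => i.
  rewrite /zero_ideal -(enum_valK i) -/(vvar _ _) substB -/(substT _ _) substTX
    enum_rankK.
  rewrite [kill (take t uppers) _]/kill; case: ifP => [|_];
    last by rewrite -/(substT _ _) substTX subrr.
  rewrite subst0 subr0 /kill def_take mem_rcons inE.
  by case/orP=> ->; rewrite ?orbT.
exists (X (nth a0 uppers t)); rewrite unfold_in substTX /kill.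
  by rewrite def_take mem_rcons inE eqxx orbT.
have -> : nth a0 uppers t \in take t uppers = false.
  apply/negP => Ht; have := uniq_uppers.
  by rewrite -(cat_take_drop t uppers) (drop_nth a0 lt_tL) cat_uniq /= Ht andbF.
have : upper (nth a0 uppers t) by rewrite -mem_uppers mem_nth.
by rewrite /upper => /negPf->; rewrite /= X_neq0.
Qed.

Local Notation zs := (base_vars (enum 'I_d)).

(** Hence the Koszul complex on these generators resolves the residue field. *)
Lemma vars_idealE f :
  add_gens (@zero_ideal S) (col_diffs uppers ++ zs) f <-> vars_ideal f.
Proof.
have VI := ideal_gen_ideal (fun f : S => exists i, f = 'X_i).
have var_in v : vars_ideal (X v) by apply: ideal_gen_incl; eexists.
split.
  apply: (ideal_gen_min VI) => g [->|]; first by case: VI.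
  rewrite mem_cat => /orP[]/mapP[v _ ->]; last exact: var_in.
  exact: is_idealB VI (var_in _) (var_in _).
have sumI := add_gens_ideal (@zero_ideal S) (col_diffs uppers ++ zs).
have base_in i : add_gens (@zero_ideal S) (col_diffs uppers ++ zs) (X (i, ord0)).
  apply: ideal_gen_incl; right; rewrite mem_cat; apply/orP; right.
  by apply/mapP; exists i; rewrite ?mem_enum.
apply: (ideal_gen_min sumI) => _ [i ->]; rewrite -(enum_valK i) -/(vvar _ _).
have [upv|] := boolP (upper (enum_val i)); last first.
  by rewrite negbK => /eqP v0; rewrite [enum_val i]surjective_pairing v0.
rewrite -(subrK (X (base (enum_val i))) (X _)).
case: (sumI) => _ sumD _; apply: sumD; last exact: base_in.
apply: ideal_gen_incl; right; rewrite mem_cat; apply/orP; left.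
by apply/mapP; exists (enum_val i); rewrite ?mem_uppers.
Qed.

Local Notation Z := (fun f => forall z, z \in zs -> B (z * f)).

Lemma corner_socle a : corner a -> Z 'X_[corner_mnm a].
Proof.
case=> _ up _ /mapP[i _ ->]; apply/quotientE; rewrite substM phi_base phi_corner.
have [w Gw le_w] := up i.
rewrite /vvar -mpolyXD mideal_mpolyX addmC.
by apply/(mon_in_merged a (Some i)); exists w.
Qed.

Lemma socle_corner f a : Z f -> (phi f)@_(corner_mnm a) != 0 ->
  ~~ mon_in G' (corner_mnm a) -> corner a.
Proof.
move=> Zf fa Ga; split=> [w Gw|i].
  apply/existsP; apply: contraR Ga => /existsPn le_w; rewrite -(addm0 (corner_mnm a)).
  by apply/(mon_in_merged a None); exists w => // i; rewrite addn0 leqNgt.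
have /Zf/quotientE : X (i, ord0) \in zs by apply/mapP; exists i; rewrite ?mem_enum.
rewrite substM phi_base => /midealP Hf; apply/(mon_in_merged a (Some i)).
by apply: contraNT fa => /Hf; rewrite mcoeffXM => ->.
Qed.

(** Coordinates of a socle element in the basis of corner monomials are its
    coefficients after the identification of columns: every other monomial outside
    the ideal has coefficient zero, by [socle_corner]. *)
Lemma socle_basis (k : nat) (a : 'I_k -> {ffun 'I_d -> nat}) (c : 'I_k -> K) f :
  injective a -> (forall b, corner b <-> exists t, b = a t) -> Z f ->
  B (f - \sum_t (c t)%:MP * 'X_[corner_mnm (a t)]) <->
  forall t, c t = (phi f)@_(corner_mnm (a t)).
Proof.
move=> inj_a cornerP Zf; rewrite quotientE.
have coefE m : (phi (f - \sum_t (c t)%:MP * 'X_[corner_mnm (a t)]))@_m =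
    (phi f)@_m - \sum_t c t * (corner_mnm (a t) == m)%:R.
  rewrite substB mcoeffB; congr (_ - _).
  rewrite /subst rmorph_sum raddf_sum; apply: eq_bigr => t _ /=.
  by rewrite -/(subst _ _) substM substC phi_corner mcoeffCM mcoeffX.
have coef_corner t : \sum_u c u * (corner_mnm (a u) == corner_mnm (a t))%:R = c t.
  rewrite (bigD1 t) //= eqxx mulr1 big1 ?addr0 // => u neq_ut.
  by rewrite (inj_eq corner_mnm_inj) (inj_eq inj_a) (negPf neq_ut) mulr0.
split=> [/midealP H t|H].
  have /H/eqP : ~~ mon_in G' (corner_mnm (a t)).
    by apply: corner_out; apply/cornerP; exists t.
  by rewrite coefE coef_corner subr_eq0 => /eqP->.
apply/midealP => m Gm; rewrite coefE.
have [/existsP[t /eqP<-]|/existsPn nt] := boolP [exists t, corner_mnm (a t) == m].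
  by rewrite coef_corner H subrr.
rewrite big1 => [|t _]; last by rewrite (negPf (nt t)) mulr0.
rewrite subr0; apply/eqP; apply/negPn/negP => fm.
have [b def_m] : exists b, m = corner_mnm b by apply: (@msupp_phi f);
  rewrite mcoeff_msupp.
have /cornerP[t def_b] : corner b by apply: (socle_corner Zf); rewrite -def_m.
by have := nt t; rewrite def_m def_b eqxx.
Qed.

(** The basis of Ext consists of cocycles lifting the corner monomials. *)
Lemma ext_dim_columns k : has_card corner k ->
  ext_dim (@vars_ideal K #|{: T}|) I (d * r)%N k.
Proof.
case=> s [uniq_s size_s corner_s].
have [F] : exists F : free_resolution (add_gens (@zero_ideal S) (col_diffs uppers ++ zs)),
    ext_iso I F (size (col_diffs uppers)) Z B.
  apply: (koszul_socle (mideal_is_ideal K G)).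
    by apply: weakly_regular_ring; rewrite ?uniq_uppers ?all_uppers ?enum_uniq.
  by case: regular_seq_columns.
rewrite size_map size_uppers => -[_ [pr [prZ pr_surj prB]]].
pose a0 : {ffun 'I_d -> nat} := [ffun=> 0%N].
pose a (t : 'I_k) := nth a0 s t.
have inj_a : injective a.
  move=> t u /eqP; rewrite nth_uniq ?size_s // => /eqP eq_tu; exact: val_inj.
have cornerP b : corner b <-> exists t, b = a t.
  rewrite -corner_s; split=> [sb|[t ->]]; last by rewrite mem_nth ?size_s.
  have lt_b : (index b s < k)%N by rewrite -size_s index_mem.
  by exists (Ordinal lt_b); rewrite /a nth_index.
have [b Hb] : exists b : nat -> 'cV[S]_(rk F (d * r)), forall t, (t < k)%N ->
    cocycle I (b t) /\ (pr *m b t) 0 0 = 'X_[corner_mnm (nth a0 s t)].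
  apply: (finite_choice 0 (R := fun t h =>
    cocycle I h /\ (pr *m h) 0 0 = 'X_[corner_mnm (nth a0 s t)])) => t lt_tk.
  have /corner_socle/pr_surj[h Hh def_h] : corner (nth a0 s t).
    by apply/corner_s; rewrite mem_nth ?size_s.
  by exists h.
exists (resolution_congr F vars_idealE), (fun t => b t); split=> [t|h Hh].
  by case: (Hb t (ltn_ord t)).
have II := mideal_is_ideal K G.
have cobE (c : {ffun 'I_k -> K}) :
    coboundary (F := F) I (h - \sum_t (c t)%:MP *: b t) <->
    forall t, c t = (phi ((pr *m h) 0 0))@_(corner_mnm (a t)).
  rewrite prB; last first.
    rewrite /cocycle mulmxBr mulmx_sumr; apply: col_inB => //.
    apply: big_ind => [||t _]; [exact: col_in0 | exact: col_inD | ].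
    by rewrite -scalemxAr; apply: col_inZ => //; case: (Hb t (ltn_ord t)).
  rewrite -(socle_basis c inj_a cornerP (prZ _ Hh)).
  have entryB (M N : 'M[S]_1) : (M - N) 0 0 = M 0 0 - N 0 0 by rewrite !mxE.
  rewrite mulmxBr mulmx_sumr entryB summxE.
  rewrite (eq_bigr (fun t => (c t)%:MP * 'X_[corner_mnm (a t)])) // => t _.
  by rewrite -scalemxAr mxE; case: (Hb t (ltn_ord t)) => _ ->.
exists [ffun t => (phi ((pr *m h) 0 0))@_(corner_mnm (a t))]; split.
  by apply/cobE => t; rewrite ffunE.
by move=> c /cobE Hc; apply/ffunP => t; rewrite ffunE Hc.
Qed.

Theorem cm_type_columns k : has_card corner k -> cm_type I k.
Proof.
move=> card_k; split; first exact: mideal_homogeneous.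
exists (d * r)%N; split.
- exact: krull_dim_columns.
- exact: depth_columns.
exact: ext_dim_columns.
Qed.

(** The monomial with exponents [a] lies outside the ideal. *)
Definition ok (a : {ffun 'I_d -> nat}) : bool :=
  all (fun w => [exists i, (a i < colsum w i)%N]) G.

Lemma okP (a : {ffun 'I_d -> nat}) : reflect (forall w, w \in G -> exists i, (a i <
  colsum w i)%N) (ok a).
Proof. by apply: (iffP allP) => H w /H => [/existsP|?]; last exact/existsP. Qed.

(** A strictly larger vector dominates [a] raised by one in some column, which a
    corner does not allow. *)
Lemma corner_max a :
  corner a <-> ok a /\ forall b : {ffun 'I_d -> nat},
    ok b -> (forall i, (a i <= b i)%N) -> b = a.
Proof.
split=> [[out up]|[/okP ok_a max_a]].
  split=> [|b /okP ok_b le_ab]; first exact/okP.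
  apply/ffunP => i; apply/eqP; rewrite eqn_leq le_ab andbT leqNgt.
  apply/negP => lt_ab; have [w Gw le_w] := up i.
  have [i' lt_i'] := ok_b w Gw; suff : (b i' < b i')%N by rewrite ltnn.
  apply: leq_trans lt_i' (leq_trans (le_w i') _).
  by case: eqP => [->|_]; rewrite ?addn1 ?addn0.
split=> // i; pose b : {ffun 'I_d -> nat} := [ffun i' => a i' + (i' == i)]%N.
have [/max_a eq_b|] := boolP (ok b).
  have : b = a by apply: eq_b => i'; rewrite ffunE leq_addr.
  move/ffunP/(_ i); rewrite ffunE eqxx => /eqP.
  by rewrite -[X in _ == X]addn0 eqn_add2l.
case/allPn=> w Gw /existsPn le_w; exists w => // i'.
by have := le_w i'; rewrite -leqNgt ffunE.
Qed.

(** Finiteness: the generators supported on a single column bound the corners. *)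
Lemma card_corner : exists k, has_card corner k.
Proof.
pose M := (\max_(w <- G) \max_i colsum w i).+1.
have bound a : corner a -> forall i, (a i < M)%N.
  case=> out _ i; have [w Gw wi] := G_column i; have [i' lt_i'] := out w Gw.
  have [eq_i|neq_i] := eqVneq i' i; last first.
    by rewrite /colsum big1 in lt_i' => [//|j _]; rewrite wi.
  rewrite -eq_i; apply: leq_trans lt_i' _; rewrite ltnW // ltnS.
  apply: leq_trans (leq_bigmax_seq _ Gw _) => //.
  exact: (leq_bigmax i').
pose up (a : {ffun 'I_d -> nat}) := [forall i : 'I_d, has (fun w => [forall i',
  colsum w i' <= a i' + (i' == i)]%N) G].
have cornerE a : reflect (corner a) (ok a && up a).
  apply: (iffP andP) => -[ok_a up_a]; split; try exact/okP.
    by move=> i; have /hasP[w Gw /forallP] := forallP up_a i; exists w.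
  apply/forallP => i; have [w Gw le_w] := up_a i; apply/hasP; exists w => //.
  exact/forallP.
pose emb (b : {ffun 'I_d -> 'I_M}) : {ffun 'I_d -> nat} := [ffun i => b i : nat].
have emb_inj : injective emb.
  by move=> b c /ffunP eq_bc; apply/ffunP => i; apply/val_inj; have := eq_bc i;
    rewrite !ffunE.
exists (size [seq emb b | b in [pred b | ok (emb b) && up (emb b)]]).
exists [seq emb b | b in [pred b | ok (emb b) && up (emb b)]]; split=> // [|a].
  by rewrite map_inj_uniq ?enum_uniq.
split=> [/mapP[b]|Ca].
  by rewrite mem_enum => /cornerE Cb ->.
have def_a : a = emb [ffun i => Ordinal (bound a Ca i)].
  by apply/ffunP => i; rewrite !ffunE.
rewrite {1}def_a map_f // mem_enum inE -def_a.
exact/cornerE.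
Qed.

End Generators.

Lemma prod_X (h : T -> nat) (Q : seq T) : uniq Q ->
  \prod_(u <- Q) X u ^+ h u = 'X_[mnm_of (fun v => if v \in Q then h v else 0%N)].
Proof.
move=> uniqQ; rewrite big_uniq //= mpolyXE_id (reindex _ (onW_bij _ (enum_rank_bij T))).
rewrite big_mkcond; apply: eq_bigr => v _ /=; rewrite mnm_ofE.
by case: ifP.
Qed.

End Columns.

(** * Counting *)

Lemma has_card_bij (A B : eqType) (P : A -> Prop) (Q : B -> Prop) (f : A -> B) k :
  (forall x y, P x -> P y -> f x = f y -> x = y) ->
  (forall y, Q y <-> exists2 x, P x & y = f x) -> has_card P k -> has_card Q k.
Proof.
move=> inj_f QE [s [uniq_s size_s sP]]; exists (map f s); split.
- by rewrite map_inj_in_uniq // => x y /sP Px /sP Py; apply: inj_f.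
- by rewrite size_map.
move=> y; rewrite QE; split=> [/mapP[x /sP Px ->]|[x /sP sx ->]]; first by exists x.
exact: map_f.
Qed.

Lemma has_card_unique (A : eqType) (P : A -> Prop) k l :
  has_card P k -> has_card P l -> k = l.
Proof.
case=> s [uniq_s <- sP] [t [uniq_t <- tP]]; apply/perm_size/uniq_perm => // x.
by apply/idP/idP => [/sP/tP|/tP/sP].
Qed.

(** * Paths *)

Section Paths.
Variables (T : finType) (g : rel T).

Lemma path_neighbour (Q : seq T) u : symmetric g ->
  sorted g Q -> 1 < size Q -> u \in Q -> exists2 v, v \in Q & g u v.
Proof.
move=> g_sym; case: Q => [//|x Q] /=; elim: Q x => [//|y Q IH] x /= /andP[gxy pQ] _.
rewrite inE => /predU1P[->|]; first by exists y; rewrite // !inE eqxx orbT.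
case: Q IH pQ => [|z Q] IH pQ.
  by rewrite inE => /eqP->; exists x; rewrite ?inE ?eqxx // g_sym.
by case/(IH y pQ isT) => v Qv guv; exists v; rewrite // inE Qv orbT.
Qed.

(** This expresses that a path is connected. *)
Lemma path_closed (Q : seq T) (C : pred T) u : sorted g Q ->
  (forall x y, x \in Q -> y \in Q -> g x y -> C x = C y) ->
  u \in Q -> C u -> all C Q.
Proof.
case: Q => [//|x Q] /= pQ closed Qu Cu.
have same : {in x :: Q, forall v, C v = C x}.
  elim: Q x pQ closed {Qu} => [|y Q IH] x /= ; first by move=> _ _ v;
    rewrite inE => /eqP->.
  case/andP=> gxy pQ closed v; rewrite inE => /predU1P[->//|Qv].
  rewrite (closed x y) ?inE ?eqxx ?orbT //.
  apply: IH => // a b Qa Qb; apply: closed; rewrite inE ?Qa ?Qb orbT //.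
by apply/(@allP _ C (x :: Q)) => v /same->; rewrite -(same u).
Qed.

Lemma unit_path_weight (Q : seq T) u : 1 < size Q -> u \in Q ->
  path_weight (@unit_weight T) Q u = 1.
Proof.
move=> size_Q Qu; apply/eqP; rewrite eqn_leq; apply/andP; split.
  by rewrite /path_weight; apply/bigmax_leqP_seq.
have [p Qp up] : exists2 p, p \in zip Q (behead Q) & (u == p.1) || (u == p.2).
  case: Q size_Q Qu => [//|x Q] /= size_Q; elim: Q x size_Q => [//|y Q IH] x _.
  rewrite inE => /predU1P[->|Qu]; first by exists (x, y); rewrite ?inE ?eqxx.
  case: Q IH Qu => [|z Q] IH Qu.
    by exists (x, y); move: Qu; rewrite !inE ?eqxx //= => ->; rewrite orbT.
  by have [p Qp up] := IH y isT Qu; exists p; rewrite // inE Qp orbT.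
exact: (leq_bigmax_seq (F := fun=> 1) p Qp up).
Qed.

End Paths.

(** * Paths in suspensions *)

Section Suspension.
Variables (d : nat) (e : rel 'I_d).
Hypotheses (e_sym : symmetric e) (e_irr : irreflexive e).

Lemma susp_sym s : symmetric (@susp d e s).
Proof.
move=> u v; rewrite /susp e_sym andbCA [u.1 == v.1]eq_sym; congr (_ || (_ && _)).
exact: orbC.
Qed.

Lemma susp_irr s : irreflexive (@susp d e s).
Proof. by move=> u; rewrite /susp e_irr !andbF eqxx /= orbb; apply/eqP/n_Sn. Qed.

(** Removing [v_(i,j')] separates the end of its column, which is too short to
    contain the path, from the rest of the graph. *)
Lemma path_down s (Q : seq ('I_d * 'I_s.+1)) (i : 'I_d) (j j' : 'I_s.+1) :
  uniq Q -> sorted (@susp d e s) Q -> s < size Q ->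
  (i, j) \in Q -> j' <= j -> (i, j') \in Q.
Proof.
move=> uniqQ pQ lt_sQ Qij le_j; apply/negPn/negP => nQ.
have lt_j : j' < j.
  rewrite ltn_neqAle le_j andbT; apply: contra nQ => /eqP/val_inj->; exact: Qij.
pose C (v : 'I_d * 'I_s.+1) := (v.1 == i) && (j' < v.2).
have closed x y : x \in Q -> susp e x y -> C x -> y \in Q -> C y.
  case: x y => [x1 x2] [y1 y2] _ /orP[/and3P[/eqP/= -> _ _]|]; first by rewrite /C andbF.
  case/andP=> /= /eqP <- adj /andP[/= /eqP-> lt_x] Qy; rewrite /C eqxx /=.
  have neq_y : y2 != j' :> nat.
    by apply: contra nQ => /eqP/val_inj<-.
  rewrite ltn_neqAle eq_sym neq_y /=; case/orP: adj => /eqP adj.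
    by rewrite adj ltnW // ltnW.
  by rewrite adj in lt_x.
have /allP allC : all C Q.
  apply: (path_closed pQ _ Qij); last by rewrite /C eqxx.
  move=> x y Qx Qy gxy; apply/idP/idP => ?; last first.
    by apply: (closed y x) => //; rewrite susp_sym.
  exact: (closed x y).
suff : size Q <= s by rewrite leqNgt lt_sQ.
rewrite -(card_uniqP uniqQ) -[X in _ <= X]mul1n.
have -> : 1 * s = #|predX (pred1 i) (predC1 (ord0 : 'I_s.+1))|.
  by rewrite cardX card1 cardC1 card_ord.
apply/subset_leq_card/subsetP => v /allC /andP[eq_i lt_v].
by rewrite !inE eq_i -val_eqE /= -lt0n (leq_ltn_trans _ lt_v).
Qed.

Definition column s i : s.+1.-tuple ('I_d * 'I_s.+1) := [tuple (i, j) | j < s.+1].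

Lemma column_path s i : is_path (r := s) (@susp d e s) (column s i).
Proof.
apply/andP; split.
  by rewrite map_inj_uniq ?enum_uniq // => j j' [].
have adj : sorted (fun a b => b == a.+1) (map val (enum 'I_s.+1)).
  rewrite val_enum_ord /=; elim: s 0 => [//|n IH] a /=.
  by rewrite eqxx IH.
rewrite sorted_map in adj; rewrite /column /= sorted_map;
  apply: sub_sorted adj => j j' /= succ_j.
by apply/orP; right; rewrite eqxx /= succ_j.
Qed.

End Suspension.

(** * Covers of unweighted graphs *)

Section UnitCovers.
Variables (T : finType) (g : rel T) (r : nat).
Hypothesis r_gt0 : 0 < r.
Local Notation unit_cover := (wpath_cover g (@unit_weight T) r).

Definition indic (A : {set T}) : {ffun T -> nat} := [ffun u => (u \in A) : nat].

Lemma supp_indic A : supp (indic A) = A.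
Proof. by apply/setP => u; rewrite inE ffunE; case: (u \in A). Qed.

Lemma indic_eq1 A : [set u | indic A u == 1] = A.
Proof. by apply/setP => u; rewrite inE ffunE; case: (u \in A). Qed.

Lemma indic_inj : injective indic.
Proof. by move=> A B eq_AB; rewrite -(supp_indic A) eq_AB supp_indic. Qed.

Lemma path_coverP (A : {set T}) :
  reflect (forall Q : r.+1.-tuple T, is_path g Q -> exists2 u, u \in A & u \in Q)
    (path_cover g r A).
Proof.
apply: (iffP forallP) => H Q; last by apply/implyP => /H[u Au Qu]; apply/existsP;
  exists u; rewrite Au.
by move/(implyP (H Q))/existsP => [u /andP[Au Qu]]; exists u.
Qed.

Lemma path_coverS (A B : {set T}) : A \subset B -> path_cover g r A -> path_cover g r B.
Proof.
move=> sAB /path_coverP H; apply/path_coverP => Q /H[u Au Qu].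
by exists u => //; apply: (subsetP sAB).
Qed.

(** On a path every unit weight is 1, so a vertex contributes to a cover only if its
    value is 1. *)
Lemma unit_coverE c : unit_cover c <-> path_cover g r [set u | c u == 1].
Proof.
have weight1 (Q : r.+1.-tuple T) u : is_path g Q -> u \in Q ->
    path_weight (@unit_weight T) Q u = 1.
  by move=> _; apply: unit_path_weight; rewrite size_tuple.
split=> [[_ H]|H].
  apply/path_coverP => Q pQ; have [u [Qu]] := H Q pQ.
  rewrite inE weight1 // => c_gt0 c_le1; exists u => //.
  by rewrite inE eqn_leq c_le1.
split=> [|Q pQ].
  by apply: path_coverS H; apply/subsetP => u; rewrite !inE => /eqP->.
have [u] := path_coverP _ H Q pQ; rewrite inE => /eqP cu Qu.
by exists u; rewrite inE weight1 // cu.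
Qed.

Lemma min_unit_coverE c :
  min_wpath_cover g (@unit_weight T) r c <->
  exists2 A, minset (path_cover g r) A & c = indic A.
Proof.
split=> [[/unit_coverE cov_c min_c]|[A /minsetP[cov_A min_A] ->]].
  have def_c : indic [set u | c u == 1] = c.
    apply: min_c; first by rewrite unit_coverE indic_eq1.
    rewrite /cover_le supp_indic; split=> [|u].
      by apply/subsetP => u; rewrite !inE => /eqP->.
    by rewrite ffunE !inE => /eqP->.
  exists [set u | c u == 1] => //; apply/minsetP; split=> // B cov_B sBc.
  apply: indic_inj; rewrite def_c; apply: min_c; first by rewrite unit_coverE indic_eq1.
  rewrite /cover_le supp_indic; split=> [|u Bu].
    by apply/subsetP => u /(subsetP sBc); rewrite !inE => /eqP->.
  by have := subsetP sBc u Bu; rewrite ffunE Bu inE => /eqP->.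
split=> [|{}c]; first by rewrite unit_coverE indic_eq1.
move=> /unit_coverE cov_c [sub_c _]; rewrite supp_indic in sub_c.
have s1c : [set u | c u == 1] \subset supp c.
  by apply/subsetP => u; rewrite !inE => /eqP->.
have c1 := min_A _ cov_c (subset_trans s1c sub_c).
have c0 : supp c = A by apply/eqP; rewrite eqEsubset sub_c -c1.
apply/ffunP => u; rewrite ffunE.
have [Au|nAu] := boolP (u \in A); first by move: Au; rewrite -c1 inE => /eqP.
by move: nAu; rewrite -c0 inE -eqn0Ngt => /eqP.
Qed.

End UnitCovers.

(** * Covers of path suspensions of an unweighted graph *)

Lemma ominA : associative omin.
Proof. by case=> [x|] [y|] [z|] //=; rewrite minnA. Qed.

Lemma omin0 : left_id None omin.
Proof. by case. Qed.

Lemma ominC : commutative omin.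
Proof. by case=> [x|] [y|] //=; rewrite minnC. Qed.

HB.instance Definition _ := Monoid.isComLaw.Build (option nat) None omin ominA ominC
  omin0.

Section LevelCovers.
Variables (d : nat) (e : rel 'I_d).
Hypothesis e_sym : symmetric e.
Variable s : nat.
Local Notation T := ('I_d * 'I_s.+1)%type.
Local Notation cover := (path_cover (@susp d e s) s.+1).
Implicit Types (a b : {ffun 'I_d -> nat}) (A : {set T}).

(** The set with the single vertex [v_(i, a_i)] in column [i], which is empty
    when [a_i] exceeds [s]. *)
Definition level a : {set T} := [set v : T | v.2 == a v.1 :> nat].

(** Covers with at most one vertex in each column; the value [s.+1] stands for a
    column without any. *)
Definition good a : Prop := (forall i, a i <= s.+1) /\ cover (level a).

Lemma in_level a i (lt_a : a i < s.+1) : (i, Ordinal lt_a) \in level a.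
Proof. by rewrite inE. Qed.

Lemma level_sub_le a b : (forall i, a i <= s.+1) -> (forall i, b i <= s.+1) ->
  level b \subset level a -> forall i, a i <= b i.
Proof.
move=> le_a le_b /subsetP sub i; have := le_b i; rewrite leq_eqVlt => /orP[/eqP->//|lt_b].
by have := sub _ (in_level lt_b); rewrite inE => /eqP <-.
Qed.

Lemma level_inj a b : (forall i, a i <= s.+1) -> (forall i, b i <= s.+1) ->
  level a = level b -> a = b.
Proof.
move=> le_a le_b eq_ab; apply/ffunP => i; apply/eqP; rewrite eqn_leq.
by rewrite !level_sub_le // eq_ab.
Qed.

Lemma susp_path_down (Q : s.+2.-tuple T) (i : 'I_d) (j j' : 'I_s.+1) :
  is_path (@susp d e s) Q -> (i, j) \in Q -> j' <= j -> (i, j') \in Q.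
Proof.
by case/andP=> uQ pQ; apply: (path_down e_sym uQ pQ); rewrite size_tuple.
Qed.

(** A path that meets a column meets it in an initial segment, so the lowest
    vertex of a cover in each column suffices. *)
Lemma cover_level A : cover A -> exists2 a, good a & level a \subset A.
Proof.
move=> /path_coverP cov_A.
pose inA i j := (i, inord j) \in A.
pose a : {ffun 'I_d -> nat} := [ffun i => find (inA i) (iota 0 s.+1)].
have le_a i : a i <= s.+1 by rewrite ffunE -[X in _ <= X](size_iota 0) find_size.
have a_min i (j : 'I_s.+1) : (i, j) \in A -> a i <= j.
  move=> Aij; rewrite leqNgt ffunE; apply/negP => /(before_find 0).
  by rewrite nth_iota // add0n /inA inord_val Aij.
exists a; last first.
  apply/subsetP => -[i j]; rewrite inE /= => /eqP def_j.
  have : has (inA i) (iota 0 s.+1) by rewrite has_find size_iota; move: def_j;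
    rewrite ffunE => <-.
  by move/(nth_find 0);
    rewrite -[find _ _](ffunE (fun i => find (inA i) _)) -/a -def_j nth_iota // add0n
      /inA inord_val.
split=> //; apply/path_coverP => Q pQ; have [[i j] Aij Qij] := cov_A Q pQ.
have lt_a : a i < s.+1 by apply: leq_ltn_trans (a_min _ _ Aij) _.
exists (i, Ordinal lt_a); first exact: in_level.
by apply: (susp_path_down pQ Qij); apply: a_min.
Qed.

Lemma minset_level A : minset cover A -> exists2 a, good a & A = level a.
Proof.
case/minsetP=> cov_A min_A; have [a good_a sub_a] := cover_level cov_A.
by exists a => //; rewrite (min_A _ _ sub_a) //; case: good_a.
Qed.

Lemma unit_max_weight u v : susp e u v -> max_weight e (@unit_weight T) u = 1.
Proof.
move=> uv; apply/eqP; rewrite eqn_leq; apply/andP; split.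
  by apply/bigmax_leqP.
by rewrite /max_weight (bigD1 v) //= leq_maxl.
Qed.

Lemma gamma_level a i : (forall i, a i <= s.+1) -> minset cover (level a) ->
  gamma e (@unit_weight T) (indic (level a)) i = if a i < s.+1 then Some (a i).+1
    else None.
Proof.
move=> le_a /minsetP[cov_a min_a]; rewrite /gamma supp_indic.
case: ifPn => [lt_a|ge_a]; last first.
  rewrite big_pred0 // => j; apply/negP => /andP[]; rewrite inE /= => /eqP def_j.
  by rewrite -def_j ltn_ord in ge_a.
(* the vertex of the column lies on a path, since the cover is minimal; so do the
   vertices below it, which therefore have neighbours and maximal weight 1 *)
have [Q pQ Qi] : exists2 Q : s.+2.-tuple T, is_path (@susp d e s) Q & (i, Ordinal
  lt_a) \in Q.
  have [/existsP[Q /andP[pQ Qi]]|/existsPn noQ] :=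
    boolP [exists Q : s.+2.-tuple T, is_path (@susp d e s) Q && ((i, Ordinal lt_a)
      \in Q)].
    by exists Q.
  have : level a :\ (i, Ordinal lt_a) = level a.
    apply: min_a; last exact: subD1set.
    apply/path_coverP => Q pQ; have [u au Qu] := path_coverP _ _ _ cov_a Q pQ.
    exists u => //; rewrite in_setD1 au andbT; apply: contra (noQ Q) => /eqP <-.
    by rewrite pQ.
  by move/setP/(_ (i, Ordinal lt_a)); rewrite in_setD1 eqxx in_level.
have weight1 (j : 'I_s.+1) : j <= a i -> max_weight e (@unit_weight T) (i, j) = 1.
  move=> le_j; have Qj : (i, j) \in Q by apply: (susp_path_down pQ Qi).
  case/andP: pQ => _ pQ.
  by have [|v _ /unit_max_weight] := path_neighbour (@susp_sym _ _ e_sym s) pQ _ Qj;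
    rewrite ?size_tuple.
rewrite (big_pred1 (Ordinal lt_a)) => [|j].
  rewrite ffunE in_level add1n; congr (Some _.+1).
  rewrite (eq_bigr (fun=> 1)) => [|k lt_k]; last by rewrite weight1 // ltnW.
  by rewrite -(big_ord_widen _ (fun=> 1) (le_a i)) sum_nat_const card_ord muln1.
rewrite ffunE inE /= -val_eqE /=; case: eqP => //= eq_j.
by rewrite weight1 // eq_j.
Qed.

Lemma p_le_level a b : (forall i, a i <= s.+1) -> (forall i, b i <= s.+1) ->
  minset cover (level a) -> minset cover (level b) ->
  p_le e (@unit_weight T) (indic (level a)) (indic (level b)) <->
  forall i, b i <= a i.
Proof.
move=> le_a le_b min_a min_b; rewrite /p_le.
have colE c i : (i \in col_supp (indic (level c))) = (c i < s.+1).
  rewrite /col_supp supp_indic; apply/imsetP/idP => [[[i' j]]|lt_c].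
    by rewrite inE /= => /eqP def_j ->; rewrite /= -def_j ltn_ord.
  by exists (i, Ordinal lt_c); rewrite ?in_level.
split=> [[/subsetP sub le_ab] i|le_ba].
  have := le_a i; rewrite leq_eqVlt => /orP[/eqP->//|lt_a].
  have lt_b : b i < s.+1 by rewrite -colE sub // colE.
  have := le_ab i; rewrite colE => /(_ lt_a).
  by rewrite !gamma_level // lt_a lt_b.
split=> [|i]; first by apply/subsetP => i; rewrite !colE; apply: leq_ltn_trans.
rewrite colE => lt_a; have lt_b : b i < s.+1 by apply: leq_ltn_trans lt_a.
by rewrite !gamma_level // lt_a lt_b /= ltnS.
Qed.

(** By [cover_level] minimal covers have at most one vertex in each column, and by
    [p_le_level] such covers are compared through the levels of these vertices; so
    [p]-minimality is maximality of the level function. *)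
Lemma p_minimalE c :
  p_minimal e (@unit_weight T) c <->
  exists2 a, good a /\ (forall b, good b -> (forall i, a i <= b i) -> b = a)
    & c = indic (level a).
Proof.
rewrite /p_minimal; split.
  case=> /(min_unit_coverE _ (ltn0Sn s))[A minA ->] no_smaller.
  have [a good_a def_A] := minset_level minA; exists a; last by rewrite def_A.
  split=> // b good_b le_ab; have [le_a _] := good_a; have [le_b cov_b] := good_b.
  have [B minB sBb] := minset_exists cov_b.
  have [b' [le_b' _] def_B] := minset_level minB.
  rewrite def_B in minB sBb; rewrite def_A in minA no_smaller.
  have le_bb' := level_sub_le le_b le_b' sBb.
  have p_le_b' : p_le e (@unit_weight T) (indic (level b')) (indic (level a)).
    by apply/p_le_level => // i; apply: leq_trans (le_ab i) (le_bb' i).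
  have [le_b'a|not_le] := boolP [forall i, b' i <= a i].
    apply/ffunP => i; apply/eqP; rewrite eqn_leq le_ab andbT.
    exact: leq_trans (le_bb' i) (forallP le_b'a i).
  case: no_smaller; exists (indic (level b')); split=> //.
    by apply/(min_unit_coverE _ (ltn0Sn s)); exists (level b').
  by move/p_le_level => H; case/negP: not_le; apply/forallP/H.
case=> a [good_a max_a] ->; have [le_a cov_a] := good_a.
have minA : minset cover (level a).
  apply/minsetP; split=> // B cov_B sBa.
  have [b good_b sbB] := cover_level cov_B; have [le_b _] := good_b.
  have eq_ba := max_a b good_b (level_sub_le le_a le_b (subset_trans sbB sBa)).
  rewrite eq_ba in sbB.
  by apply/eqP; rewrite eqEsubset sBa.
split; first by apply/(min_unit_coverE _ (ltn0Sn s)); exists (level a).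
case=> c' [/(min_unit_coverE _ (ltn0Sn s))[B minB ->]].
have [b good_b def_B] := minset_level minB; have [le_b _] := good_b.
rewrite def_B in minB * => le_p not_le_p; apply: not_le_p.
by move: (le_p); rewrite (max_a b good_b ((p_le_level le_b le_a minB minA).1 le_p)).
Qed.

End LevelCovers.

(** * Path ideals of suspensions as monomial ideals *)

Lemma ideal_ext (A : Type) (I J : A -> Prop) : (forall f, I f <-> J f) -> I = J.
Proof. by move=> IJ; apply: functional_extensionality => f;
  apply: propositional_extensionality. Qed.

Section PathGenerators.
Variables (K : fieldType) (d r : nat) (e : rel 'I_d).
Local Notation T := ('I_d * 'I_r.+1)%type.
Local Notation g := (@susp d e r).

(** Exponent vectors of the generators of a path ideal, with the exponent [w Q u]
    of the vertex [u] of the path [Q] left arbitrary. *)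
Definition path_gens q (w : seq T -> T -> nat) : seq 'X_{1..#|{: T}|} :=
  [seq mnm_of (fun v => if v \in Q then w Q v else 0)
     | Q : q.+1.-tuple T <- enum (is_path g (r := q))].

Lemma path_gensP q w m :
  reflect (exists2 Q : q.+1.-tuple T, is_path g Q
             & m = mnm_of (fun v => if v \in Q then w (Q : seq T) v else 0))
    (m \in path_gens q w).
Proof.
apply: (iffP mapP) => -[Q pQ ->]; exists Q => //; last by rewrite mem_enum.
by rewrite mem_enum in pQ.
Qed.

Lemma path_gens_ideal q (w : seq T -> T -> nat) (f : {mpoly K[#|{: T}|]}) :
  ideal_gen (fun f => exists2 Q : q.+1.-tuple T, is_path g Q &
    f = (\prod_(u <- Q) vvar K u ^+ w (Q : seq T) u)%R) f <-> mideal (path_gens q w) f.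
Proof.
rewrite -mideal_gen; split; apply: ideal_gen_min; try exact: ideal_gen_ideal.
  move=> _ [Q pQ ->]; apply: ideal_gen_incl.
  exists (mnm_of (fun v => if v \in Q then w (Q : seq T) v else 0)).
    by apply/path_gensP; exists Q.
  by apply: prod_X; case/andP: pQ.
move=> _ [_ /path_gensP[Q pQ ->] ->]; apply: ideal_gen_incl; exists Q => //.
by rewrite prod_X //; case/andP: pQ.
Qed.

End PathGenerators.

(** ** Unweighted path ideals *)

Lemma susp_map d (e : rel 'I_d) s t (f : 'I_d * 'I_s.+1 -> 'I_d * 'I_t.+1) u v :
  (f u).1 = u.1 -> (f v).1 = v.1 ->
  (f u).2 = u.2 :> nat -> (f v).2 = v.2 :> nat -> susp e (f u) (f v) = susp e u v.
Proof. by rewrite /susp -!val_eqE /= => -> -> -> ->. Qed.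

Section UnweightedPaths.
Variables (d : nat) (e : rel 'I_d).
Hypothesis e_sym : symmetric e.
Variable s : nat.
Local Notation r := s.+1.
Local Notation T := ('I_d * 'I_r.+1)%type.
Local Notation G := (path_gens e r (fun (Q : seq T) u => 1)).
Implicit Types (Q : r.+1.-tuple T) (a : {ffun 'I_d -> nat}).

Lemma path_gen_down Q (i : 'I_d) (j j' : 'I_r.+1) :
  is_path (@susp d e r) Q -> (i, j) \in Q -> j' <= j -> (i, j') \in Q.
Proof. by case/andP=> uQ pQ; apply: (path_down e_sym uQ pQ); rewrite size_tuple. Qed.

Lemma mem_column t (i i' : 'I_d) (j : 'I_t.+1) : ((i', j) \in column t i) = (i' == i).
Proof.
apply/mapP/eqP => [[j' _ [-> _]]|->]; first by [].
by exists j; rewrite ?mem_enum.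
Qed.

Lemma path_gens_fill w : w \in G -> forall (i : 'I_d) (j : 'I_r.+1),
  (w (enum_rank (i, j)) <= 1) /\
  (0 < w (enum_rank (i, j)) -> forall j' : 'I_r.+1, j' < j -> w (enum_rank (i, j')) = 1).
Proof.
case/path_gensP=> Q pQ -> i j; rewrite mnm_ofE; split; first by case: ifP.
case: ifP => // Qij _ j' /ltnW le_j; rewrite mnm_ofE.
by rewrite (path_gen_down pQ Qij le_j).
Qed.

Lemma path_gens_column (i : 'I_d) :
  exists2 w, w \in G & forall v : T, v.1 != i -> w (enum_rank v) = 0.
Proof.
exists (mnm_of (fun v => if v \in column r i then 1 else 0)).
  by apply/path_gensP; exists (column r i) => //; apply: column_path.
by case=> i' j /= neq_i; rewrite mnm_ofE mem_column (negPf neq_i).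
Qed.

Lemma path_gens_base w : w \in G -> exists i : 'I_d, 0 < w (enum_rank (i, ord0 :
  'I_r.+1)).
Proof.
case/path_gensP=> Q pQ ->; have Q0 : tnth Q ord0 \in Q by apply: mem_tnth.
exists (tnth Q ord0).1; rewrite mnm_ofE (path_gen_down (j := (tnth Q ord0).2) pQ) //.
by rewrite -surjective_pairing.
Qed.

(** By [path_gen_down] a path meets a column in an initial segment, which is
    determined by its size. *)
Lemma colsum_path Q i n : is_path (@susp d e r) Q ->
  reflect (exists2 j : 'I_r.+1, j = n :> nat & (i, j) \in Q)
    (n < colsum (mnm_of (fun v => if v \in Q then 1 else 0)) i).
Proof.
move=> pQ; rewrite /colsum (eq_bigr (fun j : 'I_r.+1 => (((i, j) \in Q) : nat)));
  last first.
  by move=> j _; rewrite mnm_ofE; case: ifP.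
have count_lt m : m <= r.+1 -> \sum_(j < r.+1) ((j < m) : nat) = m.
  move=> le_m; rewrite -big_mkcond /= -(big_ord_widen _ (fun=> 1) le_m).
  by rewrite sum_nat_const card_ord muln1.
apply: (iffP idP) => [lt_n|[j def_n Qij]]; last first.
  rewrite -def_n -[j < _]/(j.+1 <= _) -(count_lt j.+1) ?ltn_ord //.
  apply: leq_sum => j' _; case: ltnP => // le_j.
  by rewrite (path_gen_down pQ Qij).
have lt_nr : n < r.+1.
  apply: leq_trans lt_n _; rewrite -[X in _ <= X](count_lt r.+1) //.
  by apply: leq_sum => j _; rewrite ltn_ord leq_b1.
exists (Ordinal lt_nr) => //; apply: contraLR lt_n => nQ; rewrite -leqNgt.
rewrite -[X in _ <= X](count_lt n) ?(ltnW lt_nr) //.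
apply: leq_sum => j _; case: ltnP => [_|le_nj]; first exact: leq_b1.
by case: (boolP ((i, j) \in Q)) => // Qij; rewrite (path_gen_down pQ Qij) in nQ.
Qed.

Lemma ok_pathsE a : ok G a <->
  forall Q, is_path (@susp d e r) Q -> exists2 v, v \in Q & v.2 = a v.1 :> nat.
Proof.
split=> [/okP H Q pQ|H].
  have [|i /(colsum_path _ _ pQ)[j def_j Qij]] := H (mnm_of (fun v => if v \in Q then
    1 else 0)).
    by apply/path_gensP; exists Q.
  by exists (i, j).
apply/okP => _ /path_gensP[Q pQ ->]; have [[i j] Qij def_j] := H Q pQ.
by exists i; apply/(colsum_path _ _ pQ); exists j.
Qed.

(** The paths of [Sigma_r G] are the full columns and the paths of [Sigma_(r-1) G]. *)
Lemma ok_goodE a : ok G a <-> good e s a.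
Proof.
rewrite ok_pathsE; split=> [H|[le_a /path_coverP cov_a] Q pQ].
  split=> [i|].
    have [[i' j]] := H _ (column_path e r i); rewrite mem_column /= => /eqP-> <-.
    by rewrite -ltnS.
  apply/path_coverP => Q /andP[uQ pQ].
  pose f (v : 'I_d * 'I_s.+1) : T := (v.1, widen_ord (leqnSn r) v.2).
  have f_inj : injective f by case=> [i j] [i' j'] [-> /val_inj->].
  have [|v] := H (map_tuple f Q).
    by rewrite /is_path map_inj_uniq // uQ /= sorted_map;
      apply: sub_sorted pQ => u v /=; rewrite susp_map.
  by case/mapP=> u Qu -> /= def_u; exists u; rewrite // inE def_u.
have [/existsP[i Qi]|/existsPn low] := boolP [exists i, (i, ord_max) \in Q].
  have lt_a : a i < r.+1 by rewrite ltnS le_a.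
  by exists (i, Ordinal lt_a) => //; apply: (path_gen_down pQ Qi); apply: le_a.
have {low} low v : v \in Q -> v.2 < r.
  case: v => i j Qij; rewrite ltn_neqAle -ltnS ltn_ord andbT.
  by apply: contra (low i) => /eqP eq_j; rewrite (_ : ord_max = j) //; apply: val_inj.
pose f (v : T) : 'I_d * 'I_s.+1 := (v.1, inord v.2).
have f2 v : v \in Q -> (f v).2 = v.2 :> nat by move=> /low lt_v; rewrite /= inordK.
have [|u] := cov_a (map_tuple f Q).
  case/andP: pQ => uQ pQ; rewrite /is_path map_inj_in_uniq ?uQ /= => [|u v Qu Qv eq_f].
    rewrite sorted_map; apply: (sub_in_sorted (P := mem Q)) pQ => [u v Qu Qv /=|].
      by rewrite susp_map ?f2.
    exact/allP.
  have [eq1 _] := eq_f; move/(congr1 (fun v : 'I_d * 'I_s.+1 => v.2 : nat)): eq_f;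
    rewrite !f2 // => eq2.
  by rewrite (surjective_pairing u) eq1 (surjective_pairing v); congr pair;
    apply: val_inj.
rewrite inE => /eqP def_u /mapP[v Qv eq_u]; exists v => //.
by move: def_u; rewrite eq_u f2.
Qed.

Theorem path_ideal_type (K : fieldType) : exists k,
  cm_type (path_ideal (@susp d e r) K r) k /\
  has_card (p_minimal e (@unit_weight ('I_d * 'I_s.+1))) k.
Proof.
have [k card_k] := card_corner path_gens_column.
exists k; split.
  have -> : path_ideal (@susp d e r) K r = fun f => mideal G f.
    by apply: ideal_ext => f; exact: (@path_gens_ideal K d r e r (fun _ _ => 1) f).
  exact: (cm_type_columns K (cap := fun=> 1) path_gens_fill path_gens_column
    path_gens_base card_k).
apply: (has_card_bij (f := fun a => indic (level s a))) card_k.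
  move=> a b /corner_max[/ok_goodE[le_a _] _] /corner_max[/ok_goodE[le_b _] _].
  by move/indic_inj; apply: level_inj.
move=> c; rewrite p_minimalE //; split=> -[a].
  case=> good_a max_a ->; exists a => //; apply/corner_max; split; first exact/ok_goodE.
  by move=> b /ok_goodE; apply: max_a.
case/corner_max=> /ok_goodE good_a max_a ->; exists a => //; split=> // b /ok_goodE.
exact: max_a.
Qed.

End UnweightedPaths.

(** ** Weighted edge ideals *)

Section WeightedEdges.
Variables (d : nat) (e : rel 'I_d) (om : 'I_d -> 'I_d -> nat).
Variable la : 'I_d * 'I_2 -> 'I_d * 'I_2 -> nat.
Hypotheses (e_sym : symmetric e) (e_irr : irreflexive e).
Hypothesis om_weight : edge_weighting e om.
Hypothesis la_weight : susp_weighting e om la.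
Hypothesis la_bounded : susp_bounded e la.
Local Notation T := ('I_d * 'I_2)%type.
Local Notation g := (@susp d e 1).
Local Notation G := (path_gens e 1 (path_weight la)).
Local Notation top := (ord_max : 'I_2).
Local Notation pend i := (la (i, ord0) (i, top)).
Implicit Types (a b : {ffun 'I_d -> nat}) (c : {ffun 'I_d -> nat}).

Lemma is_edge (S : finType) (h : rel S) (Q : 2.-tuple S) :
  is_path h Q -> exists u v, h u v /\ Q = [tuple u; v].
Proof.
case: Q => -[|u [|v []]] //= sz /andP[_ /=]; rewrite andbT => huv.
by exists u, v; split=> //; apply: val_inj.
Qed.

Lemma edge_is_path (S : finType) (h : rel S) u v : irreflexive h ->
  h u v -> is_path h [tuple u; v].
Proof.
move=> h_irr huv; rewrite /is_path /= huv inE !andbT.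
by apply: contraTneq huv => ->; rewrite h_irr.
Qed.

Lemma edge_weightE (S : finType) (w : S -> S -> nat) u v x :
  x \in [:: u; v] -> path_weight w [:: u; v] x = w u v.
Proof. by rewrite /path_weight big_cons big_nil maxn0 !inE /= => ->. Qed.

Definition edge_mnm (u v : T) : 'X_{1..#|{: T}|} :=
  mnm_of (fun x => if x \in [:: u; v] then la u v else 0).

Lemma edge_gensP w :
  w \in G <-> exists u v, g u v /\ w = edge_mnm u v.
Proof.
have g_irr := @susp_irr d e e_irr 1.
have mnmE u v : mnm_of (fun x => if x \in [:: u; v] then path_weight la [:: u;
  v] x else 0)
    = edge_mnm u v.
  by apply: mnm_eqT => x; rewrite !mnm_ofE; case: ifP => // /edge_weightE->.
split=> [/path_gensP[Q /is_edge[u [v [guv ->]]] ->]|[u [v [guv ->]]]].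
  by exists u, v; split=> //; rewrite -mnmE.
by apply/path_gensP; exists [tuple u; v]; rewrite ?mnmE //; apply: edge_is_path.
Qed.

Lemma pend_edge i : g (i, ord0) (i, top).
Proof. by rewrite /susp /= eqxx. Qed.

Lemma pend_gt0 i : 0 < pend i.
Proof. by case: la_weight => wla _; case: (wla _ _ (pend_edge i)). Qed.

Lemma om_le_pend i j : e i j -> om i j <= pend i.
Proof.
move=> eij; case: la_weight => _ <- //; have [le_i _] := la_bounded eij.
by rewrite (_ : top = inord 1) //; apply: val_inj; rewrite /= inordK.
Qed.

Lemma edge_cases w : w \in G ->
  (exists i j, e i j /\ forall v, w (enum_rank v) =
     if (v.2 == ord0) && ((v.1 == i) || (v.1 == j)) then om i j else 0) \/
  (exists i, forall v, w (enum_rank v) = if v.1 == i then pend i else 0).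
Proof.
case/edge_gensP=> -[i k] [[j l] [guv ->]].
have ord2 (x : 'I_2) : x = ord0 \/ x = top.
  by case: x => [[|[|]]] // ?; [left | right]; apply: val_inj.
move: guv; rewrite /susp /= => /orP[/and3P[/eqP-> /eqP-> eij]|/andP[/eqP <- adj]].
  left; exists i, j; split=> // -[v1 v2];
    rewrite mnm_ofE !inE !xpair_eqE /= -andb_orl andbC.
  by case: la_weight => _ ->.
right; exists i => -[v1 v2]; rewrite mnm_ofE !inE !xpair_eqE /=.
have [[-> ->]|[-> ->]] : (k = ord0 /\ l = top) \/ (k = top /\ l = ord0).
- by move: adj; case: (ord2 k) => ->; case: (ord2 l) => ->; rewrite ?eqxx //;
  [left|right].
- by case: (ord2 v2) => ->; rewrite ?andbT ?andbF ?orbF.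
case: la_weight => wla _; have [_ <-] := wla _ _ (pend_edge i).
by case: (ord2 v2) => ->; rewrite ?andbT ?andbF ?orbF.
Qed.

Lemma cross_gen i j : e i j -> exists2 w, w \in G & forall v, w (enum_rank v) =
  if (v.2 == ord0) && ((v.1 == i) || (v.1 == j)) then om i j else 0.
Proof.
move=> eij; exists (edge_mnm (i, ord0) (j, ord0)).
  by apply/edge_gensP; exists (i, ord0), (j, ord0); rewrite /susp /= eij.
move=> [v1 v2]; rewrite mnm_ofE !inE !xpair_eqE /= -andb_orl andbC.
by case: la_weight => _ ->.
Qed.

Lemma pend_gen i : exists2 w, w \in G & forall v, w (enum_rank v) =
  if v.1 == i then pend i else 0.
Proof.
exists (edge_mnm (i, ord0) (i, top)).
  by apply/edge_gensP; exists (i, ord0), (i, top); rewrite pend_edge.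
move=> [v1 v2]; rewrite mnm_ofE !inE !xpair_eqE /= -andb_orr.
by case: v2 => [[|[|]]] //= ?; rewrite ?andbT.
Qed.

(** This is where no edge may be heavier than the pendant ones: the largest exponent
    of [X_(i,0)] is then the weight of the edge that contains [X_(i,1)]. *)
Lemma edge_gens_fill w : w \in G -> forall (i : 'I_d) (j : 'I_2),
  (w (enum_rank (i, j)) <= pend i) /\
  (0 < w (enum_rank (i, j)) -> forall j' : 'I_2, j' < j -> w (enum_rank (i, j')) =
    pend i).
Proof.
case/edge_cases=> [[i [j [eij wE]]]|[i wE]] i' j'; rewrite !wE /=; split.
- case: andP => // -[_ /orP[]/eqP->]; first exact: om_le_pend.
  by have [_ ->] := om_weight eij; apply: om_le_pend; rewrite e_sym.
- by case: eqP => //= -> _ j''.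
- by case: eqP => // ->.
by case: eqP => // -> _ j'' _; rewrite wE /= eqxx.
Qed.

Lemma edge_gens_column i : exists2 w, w \in G & forall v : T, v.1 != i -> w
  (enum_rank v) = 0.
Proof. by have [w Gw wE] := pend_gen i; exists w => // v /negPf nv; rewrite wE nv. Qed.

Lemma edge_gens_base w : w \in G -> exists i, 0 < w (enum_rank (i, ord0 : 'I_2)).
Proof.
case/edge_cases=> [[i [j [eij wE]]]|[i wE]]; exists i; rewrite wE /= ?eqxx /=.
  by case: (om_weight eij).
exact: pend_gt0.
Qed.

Lemma ok_edgesE a : ok G a <->
  (forall i, a i < (pend i).*2) /\
  (forall i j, e i j -> a i < om i j \/ a j < om i j).
Proof.
have colsum2 w i : colsum w i = w (enum_rank (i, ord0)) + w (enum_rank (i, top)).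
  by rewrite /colsum big_ord_recl big_ord1; congr (_ + w (enum_rank (i, _)));
    apply: val_inj.
split=> [/okP H|[lt_a cov_a]].
  split=> [i|i j eij].
    have [w Gw wE] := pend_gen i; have [i'] := H w Gw; rewrite colsum2 !wE /= addnn.
    by case: eqP => // ->.
  have [w Gw wE] := cross_gen eij; have [i'] := H w Gw; rewrite colsum2 !wE /= addn0.
  by case: eqP => [->|_]; [left | case: eqP => // ->; right].
apply/okP => w /edge_cases[[i [j [eij wE]]]|[i wE]].
  case: (cov_a i j eij) => lt_om; [exists i | exists j].
    by rewrite colsum2 !wE /= eqxx addn0.
  by rewrite colsum2 !wE /= eqxx orbT addn0.
by exists i; rewrite colsum2 !wE /= eqxx addnn.
Qed.

(** The cover corresponding to an exponent vector: [a i < om i j] holds exactly when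
    the edge [ij] is covered by [i] with value [(a i).+1]. The largest exponent
    that the pendant generator of column [i] allows stands for [i] not being in the
    cover. *)
Definition cover_of a : {ffun 'I_d -> nat} :=
  [ffun i => if a i == (pend i).*2.-1 then 0 else (a i).+1].

(** An inverse of [cover_of] on minimal covers, which also turns other covers into
    exponent vectors by discarding their vertices of too large value. *)
Definition expo_of c : {ffun 'I_d -> nat} :=
  [ffun i => if 0 < c i < (pend i).*2 then (c i).-1 else (pend i).*2.-1].

Lemma pend2_gt0 i : 0 < (pend i).*2.
Proof. by rewrite double_gt0 pend_gt0. Qed.

Lemma expo_of_bounded c i : expo_of c i < (pend i).*2.
Proof.
rewrite ffunE; have := pend2_gt0 i; case: ifP => [/andP[c_gt0 lt_c] _|_].
  by apply: leq_ltn_trans lt_c; apply: leq_pred.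
by case: (_.*2).
Qed.

Lemma cover_ofK a : (forall i, a i < (pend i).*2) -> expo_of (cover_of a) = a.
Proof.
move=> lt_a; apply/ffunP => i; rewrite !ffunE; have lt_ai := lt_a i.
case: eqP => [->|neq] //=; rewrite ifT //.
by rewrite -(prednK (pend2_gt0 i)) ltnS ltn_neqAle -ltnS (prednK (pend2_gt0 i)) lt_ai
  andbT; apply/eqP.
Qed.

(** Since [om i j <= pend i < 2 * pend i], neither the truncation of large values
    of [c] nor the exponent of the absent vertices interferes with the edges of
    the graph. *)
Lemma expo_of_cross c i j : e i j -> (expo_of c i < om i j) = (0 < c i <= om i j).
Proof.
move=> eij; have [om_gt0 _] := om_weight eij; have le_om := om_le_pend eij.
have lt_om : om i j < (pend i).*2.
  by apply: leq_ltn_trans le_om _; rewrite -addnn -[X in X < _]addn0 ltn_add2l pend_gt0.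
rewrite ffunE; case: ifP => [/andP[c_gt0 lt_c]|nc].
  by rewrite c_gt0 /= -[c i in RHS](prednK c_gt0).
have -> : (0 < c i <= om i j) = false.
  by apply: contraFF nc => /andP[-> le_c]; rewrite (leq_ltn_trans le_c).
by apply/negbTE; rewrite -leqNgt -ltnS prednK // pend2_gt0.
Qed.

Lemma edge_coverE c : wpath_cover e om 1 c <-> ok G (expo_of c).
Proof.
have om_sym i j : e i j -> om i j = om j i by case/om_weight.
rewrite ok_edgesE; split=> [[_ H]|[_ H]].
  split=> [i|i j eij]; first exact: expo_of_bounded.
  have [u [Qu]] := H _ (edge_is_path e_irr eij).
  rewrite inE edge_weightE // => c_gt0 c_le.
  have /orP[/eqP def_u|/eqP def_u] : (u == i) || (u == j) by rewrite !inE in Qu.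
    by rewrite def_u in c_gt0 c_le; left; rewrite expo_of_cross // c_gt0.
  rewrite def_u in c_gt0 c_le; right.
  by rewrite om_sym // expo_of_cross 1?e_sym // c_gt0 -om_sym.
have cov (Q : 2.-tuple 'I_d) : is_path e Q ->
    exists u, [/\ u \in Q, u \in supp c & c u <= path_weight om Q u].
  case/is_edge=> i [j [eij ->]]; case: (H i j eij).
    rewrite expo_of_cross // => /andP[c_gt0 c_le].
    by exists i; rewrite inE edge_weightE ?inE ?eqxx.
  rewrite om_sym // expo_of_cross 1?e_sym // -om_sym // => /andP[c_gt0 c_le].
  by exists j; rewrite [j \in supp c]inE edge_weightE ?inE ?eqxx ?orbT.
split=> //; apply/forallP => Q; apply/implyP => /cov[u [Qu cu _]].
by apply/existsP; exists u; rewrite cu.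
Qed.

Lemma cover_of_expo_of c i :
  cover_of (expo_of c) i = if 0 < c i < (pend i).*2 then c i else 0.
Proof.
rewrite !ffunE; have [/andP[c_gt0 lt_c]|_] := boolP (0 < c i < _); last by rewrite eqxx.
by rewrite -eqSS !prednK ?pend2_gt0 // (ltn_eqF lt_c).
Qed.

(** [cover_of] reverses the orders, and [cover_of (expo_of c)] is a cover below [c]
    whenever [c] is one; so minimal covers come from maximal exponent vectors. *)
Lemma min_edge_coverE c : min_wpath_cover e om 1 c <->
  exists2 a, corner G a & c = cover_of a.
Proof.
have cover_ok a : ok G a -> wpath_cover e om 1 (cover_of a).
  by move=> ok_a; apply/edge_coverE; rewrite cover_ofK //; case/ok_edgesE: ok_a.
split=> [[/edge_coverE ok_c min_c]|[a /corner_max[ok_a max_a] ->]].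
  have def_c : cover_of (expo_of c) = c.
    apply: min_c; [exact: cover_ok | split].
      by apply/subsetP => i; rewrite !inE cover_of_expo_of; case: ifP => // /andP[].
    by move=> i; rewrite inE cover_of_expo_of; case: ifP.
  exists (expo_of c) => //; apply/corner_max; split=> // b ok_b le_b.
  have [lt_b _] := (ok_edgesE b).1 ok_b.
  rewrite -(cover_ofK lt_b); congr expo_of; apply: min_c; first exact: cover_ok.
  have le_cb i : cover_of b i != 0 -> 0 < c i <= cover_of b i.
    have := le_b i; have := lt_b i; rewrite -{2 3}def_c ![cover_of _ i]ffunE.
    case: (b i =P _) => // b_neq lt_bi le_bi _.
    have lt_bp : b i < (pend i).*2.-1.
      by rewrite ltn_neqAle -ltnS prednK ?pend2_gt0 // lt_bi andbT; apply/eqP.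
    by rewrite (ltn_eqF (leq_ltn_trans le_bi lt_bp)) /= ltnS.
  split=> [|i]; last by rewrite inE lt0n => /le_cb/andP[].
  by apply/subsetP => i; rewrite !inE lt0n => /le_cb/andP[].
split=> [|{}c cov_c [/subsetP sub_c le_c]]; first exact: cover_ok.
have [lt_a _] := (ok_edgesE a).1 ok_a.
have c_supp i : 0 < c i -> a i != (pend i).*2.-1 /\ a i < c i.
  move=> c_gt0; have ci : i \in supp c by rewrite inE.
  by have := sub_c i ci; have := le_c i ci; rewrite inE ffunE; case: eqP.
have le_ac i : a i <= expo_of c i.
  have := lt_a i; rewrite ffunE; case: ifP => [/andP[c_gt0 _] _|_].
    by rewrite -ltnS prednK //; case: (c_supp i c_gt0).
  by rewrite -{1}(prednK (pend2_gt0 i)) ltnS.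
have eq_a := max_a _ ((edge_coverE c).1 cov_c) le_ac.
apply/ffunP => i; rewrite -eq_a cover_of_expo_of; case: ifP => //.
have [//|c_gt0] := posnP (c i); have [a_neq _] := c_supp i c_gt0.
by move=> c_big; case/eqP: a_neq; rewrite -eq_a ffunE c_gt0 /= in c_big *; rewrite c_big.
Qed.

Theorem weighted_edge_ideal_type (K : fieldType) : exists k,
  cm_type (wpath_ideal g K la 1) k /\ has_card (min_wpath_cover e om 1) k.
Proof.
have [k card_k] := card_corner edge_gens_column.
exists k; split.
  have -> : wpath_ideal g K la 1 = fun f => mideal G f.
    by apply: ideal_ext => f; exact: (@path_gens_ideal K d 1 e 1 (path_weight la) f).
  exact: (cm_type_columns K (cap := fun v => pend v.1) edge_gens_fill edge_gens_column
    edge_gens_base card_k).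
apply: (has_card_bij (f := cover_of)) card_k; last exact: min_edge_coverE.
move=> a b /corner_max[/ok_edgesE[lt_a _] _] /corner_max[/ok_edgesE[lt_b _] _] eq_ab.
by rewrite -(cover_ofK lt_a) eq_ab cover_ofK.
Qed.

End WeightedEdges.

(** ** Edge ideals *)

Lemma unit_weight_edge_ideal (K : fieldType) (T : finType) (g : rel T) :
  irreflexive g -> wpath_ideal g K (@unit_weight T) 1 = edge_ideal g K.
Proof.
move=> g_irr; have edge_prod u v : g u v ->
    (\prod_(x <- [:: u; v]) vvar K x ^+ path_weight (@unit_weight T) [:: u; v] x
       = vvar K u * vvar K v)%R.
  by move=> guv; rewrite big_cons big_seq1 !edge_weightE ?inE ?eqxx ?orbT.
apply: ideal_ext => f; split; apply: ideal_gen_min; try exact: ideal_gen_ideal.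
  move=> _ [Q /is_edge[u [v [guv ->]]] ->]; apply: ideal_gen_incl.
  by exists u, v; rewrite edge_prod.
move=> _ [u [v [guv ->]]]; apply: ideal_gen_incl.
by exists [tuple u; v]; rewrite ?edge_prod //; apply: edge_is_path.
Qed.

Lemma card_min_unit_covers (T : finType) (g : rel T) :
  has_card (min_wpath_cover g (@unit_weight T) 1) #|min_vertex_covers g|.
Proof.
have : has_card (fun A => A \in min_vertex_covers g) #|min_vertex_covers g|.
  by exists (enum (min_vertex_covers g)); rewrite enum_uniq -cardE; split=> // A;
    rewrite mem_enum.
apply: (has_card_bij (f := @indic T)) => [A B _ _|c]; first exact: indic_inj.
rewrite min_unit_coverE //; split=> -[A].
  by move=> minA ->; exists A; rewrite ?inE.
by rewrite inE => minA ->; exists A.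
Qed.

Theorem corollary2p28 (K : fieldType) (d : nat) (e : rel 'I_d)
    (d_gt0 : 0 < d) (e_sym : symmetric e) (e_irr : irreflexive e) :
  [/\
      forall (r : nat) (om : 'I_d -> 'I_d -> nat)
        (la : 'I_d * 'I_r.+1 -> 'I_d * 'I_r.+1 -> nat),
        0 < r -> edge_weighting e om ->
        susp_weighting e om la -> susp_bounded e la ->
        exists k,
          cm_type (path_ideal (@susp d e r) K r) k /\
          has_card (p_minimal e (@unit_weight ('I_d * 'I_r.-1.+1))) k,
      forall (om : 'I_d -> 'I_d -> nat)
        (la : 'I_d * 'I_2 -> 'I_d * 'I_2 -> nat),
        edge_weighting e om ->
        susp_weighting e om la -> susp_bounded e la ->
        exists k,
          cm_type (wpath_ideal (@susp d e 1) K la 1) k /\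
          has_card (min_wpath_cover e om 1) k
    &
      cm_type (edge_ideal (@susp d e 1) K) #|min_vertex_covers e|].
Proof.
split.
- by case=> // s om la _ _ _ _; apply: path_ideal_type.
- by move=> om la om_weight la_weight la_bounded; apply: weighted_edge_ideal_type.
have [] := @weighted_edge_ideal_type d e (@unit_weight _) (@unit_weight _) e_sym
  e_irr _ _ _ K.
- by [].
- by [].
- by [].
move=> k; rewrite unit_weight_edge_ideal => [[typeI card_k]|]; last exact: susp_irr.
by rewrite (has_card_unique (card_min_unit_covers e) card_k).
Qed.
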